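(* For $t\ge 0$ let $\lambda_t$ be the probability distribution on $\mathbb{T}$ of the free unitary Brownian motion $U_t$, and let $\mu=\frac{\delta_1+\delta_{-1}}{2}$, considered as a probability measure on the unit circle $\mathbb{T}$. Denote respectively by $\boxtimes$, $*$, $\uplus^{\times}$ and $\triangleright$ the free, classical, boolean and monotone multiplicative convolutions of probability measures on $\mathbb{T}$. Then, for all $t\ge 0$: (1) the measure $(\mu\boxtimes\mu)\boxtimes\lambda_t$ coincides with $\mu\boxtimes\mu$; (2) the push-forward of $(\mu*\mu)\boxtimes\lambda_t$ by the map $z\mapsto z^2$ coincides with the law $\lambda_{2t}$ of $U_{2t}$; (3) the push-forward of $(\mu\uplus^{\times}\mu)\boxtimes\lambda_t$ by the map $z\mapsto z^3$ coincides with the law $\lambda_{3t}$ of $U_{3t}$; (4) the push-forward of $(\mu\triangleright\mu)\boxtimes\lambda_t$ by the map $z\mapsto z^4$ coincides with the law $\lambda_{4t}$ of $U_{4t}$.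
   Context: The law $\lambda_t$ of the free unitary Brownian motion at time $t$ is the probability measure on $\mathbb{T}$ with moments $$\int_{\mathbb{T}}\zeta^k\,d\lambda_t(\zeta)=\tau(U_t^k)=e^{-kt/2}\sum_{j=0}^{k-1}\frac{(-t)^j}{j!}\binom{k}{j+1}k^{j-1},\qquad k\ge 1;$$ equivalently, with the notation below, its $\Sigma$-transform $\Sigma_{\lambda_t}(z)=\frac1z\chi_{\lambda_t}^{-1}(z)$ equals $\exp\left(\frac t2\frac{1+z}{1-z}\right)$ near $0$, where $\chi_{\lambda_t}^{-1}$ is the inverse function of $\chi_{\lambda_t}$ in a neighborhood of $0$. For a probability measure $\mu$ on $\mathbb{T}$ and $z$ in the open unit disc $\mathbb{D}$, let $\psi_\mu(z)=\sum_{n\ge1}z^n\int_{\mathbb{T}}\zeta^n\,d\mu(\zeta)$ be the moment generating function, $\chi_\mu=\frac{\psi_\mu}{1+\psi_\mu}$, and $F_\mu(z)=\frac1z\chi_\mu(z)$. For probability measures $\mu_1,\mu_2$ on $\mathbb{T}$: - the free multiplicative convolution $\mu_1\boxtimes\mu_2$ is the law of $uv$, where $u,v$ are freely independent unitaries with laws $\mu_1,\mu_2$; - the classical multiplicative convolution $\mu_1*\mu_2$ is the law of the product of two (classically) independent $\mathbb{T}$-valued random variables with laws $\mu_1,\mu_2$; - the boolean multiplicative convolution $\mu_1\uplus^{\times}\mu_2$ is the probability measure on $\mathbb{T}$ uniquely determined by $F_{\mu_1\uplus^{\times}\mu_2}(z)=F_{\mu_1}(z)F_{\mu_2}(z)$;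 - the monotone multiplicative convolution $\mu_1\triangleright\mu_2$ is the probability measure on $\mathbb{T}$ uniquely determined by $\chi_{\mu_1\triangleright\mu_2}(z)=\chi_{\mu_1}(\chi_{\mu_2}(z))$. *)

(* Defs.v *)
From HB Require Import structures.
From mathcomp Require Import all_boot all_order all_algebra.
From mathcomp Require Import all_classical all_reals all_analysis.
From mathcomp Require Import complex.

Set Implicit Arguments.
Unset Strict Implicit.
Unset Printing Implicit Defensive.
Import Order.TTheory GRing.Theory Num.Theory.
Import numFieldNormedType.Exports.

Local Open Scope classical_set_scope.
Local Open Scope ring_scope.
Local Open Scope complex_scope.

Definition circle_point (R : realType) : Type := {z : R[i] | `|z| == 1}.

Section circle_structures.
Variable R : realType.

Lemma circle_oneP : `|1 : R[i]| == 1.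
Proof. by rewrite normr1. Qed.

Lemma circle_mulP (x y : circle_point R) : `|sval x * sval y| == 1.
Proof. by rewrite normrM (eqP (svalP x)) (eqP (svalP y)) mulr1. Qed.

Lemma circle_oppP (x : circle_point R) : `|- sval x| == 1.
Proof. by rewrite normrN (svalP x). Qed.

Lemma circle_expP (n : nat) (x : circle_point R) : `|sval x ^+ n| == 1.
Proof. by rewrite normrX (eqP (svalP x)) expr1n. Qed.

HB.instance Definition _ := Choice.on (circle_point R).
HB.instance Definition _ := isPointed.Build (circle_point R)
  (exist (fun z : R[i] => `|z| == 1) 1 circle_oneP).

Definition circle_coord (x : circle_point R) : R * R :=
  (complex.Re (sval x), complex.Im (sval x)).

End circle_structures.

(* The unit circle with its Borel sigma-algebra, i.e. the trace on the circle
   of the Borel sigma-algebra of the plane. *)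
Definition circle (R : realType) :=
  g_sigma_algebra_preimageType (@circle_coord R).

HB.instance Definition _ (R : realType) :=
  Measurable.on (circle R).

Section circle_operations.
Variable R : realType.

Definition circle_val (x : circle R) : R[i] := sval x.

Definition circle_one : circle R :=
  exist (fun z : R[i] => `|z| == 1) 1 (circle_oneP R).
Definition circle_opp (x : circle R) : circle R :=
  exist (fun z : R[i] => `|z| == 1) (- sval x) (circle_oppP x).
Definition circle_mul (x y : circle R) : circle R :=
  exist (fun z : R[i] => `|z| == 1) (sval x * sval y) (circle_mulP x y).
Definition circle_pow (n : nat) (x : circle R) : circle R :=
  exist (fun z : R[i] => `|z| == 1) (sval x ^+ n) (circle_expP n x).

End circle_operations.

Section two_point_law.
Variable R : realType.

Definition two_point_law : set (circle R) -> \bar R :=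
  measure_add (mscale (2^-1)%:nng (dirac (circle_one R)))
              (mscale (2^-1)%:nng (dirac (circle_opp (circle_one R)))).

HB.instance Definition _ := Measure.on two_point_law.

Lemma two_point_law_setT : two_point_law setT = 1%E.
Proof.
transitivity ((2^-1 : R)%:E * 1 + (2^-1 : R)%:E * 1)%E.
  by rewrite /two_point_law measure_addE; congr (_ * _ + _ * _)%E; exact: diracT.
by rewrite !mule1 -EFinD -div1r -splitr.
Qed.

HB.instance Definition _ :=
  Measure_isProbability.Build _ _ _ two_point_law two_point_law_setT.

End two_point_law.
Arguments two_point_law R : clear implicits.

Definition same_law (R : realType) (m1 m2 : set (circle R) -> \bar R) : Prop :=
  forall A : set (circle R), measurable A -> m1 A = m2 A.

Section moments.
Variable R : realType.

(* The library has no integral of complex-valued functions: integrate the real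
   and the imaginary part separately. *)
Definition moment (m : probability (circle R) R) (k : nat) : R[i] :=
  (\int[m]_x complex.Re (circle_val x ^+ k)) +i* (\int[m]_x complex.Im (circle_val x ^+ k)).

Definition free_ubm_moment (t : R) (k : nat) : R :=
  expR (- (k%:R * t) / 2) *
  \sum_(j < k) ((- t) ^+ j / j`!%:R * 'C(k, j.+1)%:R * k%:R ^ (j%:Z - 1)).

(* [m] is the law of the free unitary Brownian motion at time [t].  The moments
   of positive order determine [m], those of negative order being their
   conjugates. *)
Definition free_ubm_law (t : R) (m : probability (circle R) R) : Prop :=
  forall k : nat, (1 <= k)%N -> moment m k = (free_ubm_moment t k)%:C.

Definition psi (m : probability (circle R) R) (z : R[i]) : R[i] :=
  limn (fun N => (\sum_(1 <= n < N) z ^+ n * moment m n : R[i]^o)).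

Definition chi (m : probability (circle R) R) (z : R[i]) : R[i] :=
  psi m z / (1 + psi m z).

Definition Ftrans (m : probability (circle R) R) (z : R[i]) : R[i] :=
  z^-1 * chi m z.

End moments.

(* The state is neither required to be tracial nor faithful: the moments of a
   product of two free unitaries depend only on their two laws, so that the
   relation [is_free_mconv] below is the same with either requirement. *)
Record star_prob_space (R : realType) := StarProbSpace {
  nc_alg :> algType R[i];
  nc_star : nc_alg -> nc_alg;
  nc_state : {scalar nc_alg};
  nc_starK : involutive nc_star;
  nc_starD : {morph nc_star : a b / a + b};
  nc_starZ : forall (c : R[i]) a, nc_star (c *: a) = (c^*)%R *: nc_star a;
  nc_starM : forall a b, nc_star (a * b) = nc_star b * nc_star a;
  nc_state1 : nc_state 1 = 1;
  nc_state_ge0 : forall a, 0 <= nc_state (nc_star a * a)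
}.

Section free_probability.
Variables (R : realType) (A : star_prob_space R).

Definition nc_unitary (u : A) : Prop :=
  nc_star u * u = 1 /\ u * nc_star u = 1.

(* Negative powers need not be mentioned: by positivity the state commutes with
   conjugation. *)
Definition has_law (u : A) (m : probability (circle R) R) : Prop :=
  forall k : nat, nc_state A (u ^+ k) = moment m k.

Definition star_subalg (S : set A) : Prop :=
  [/\ S 1,
      forall (c : R[i]) a b, S a -> S b -> S (c *: a + b),
      forall a b, S a -> S b -> S (a * b)
    & forall a, S a -> S (nc_star a)].

Definition gen_star_subalg (u : A) : set A :=
  [set a | forall S : set A, star_subalg S -> S u -> S a].

(* An element of [s] is a factor [p.2] tagged by the index [p.1] of the
   subalgebra it is taken from; consecutive factors have distinct tags. *)
Definition free_indep_subalg (B : bool -> set A) : Prop :=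
  forall s : seq (bool * A),
    s != [::] ->
    sorted (fun p q => p.1 != q.1) s ->
    (forall p, p \in s -> B p.1 p.2 /\ nc_state A p.2 = 0) ->
    nc_state A (\prod_(p <- s) p.2) = 0.

Definition free_indep (u v : A) : Prop :=
  free_indep_subalg
    (fun b => if b then gen_star_subalg u else gen_star_subalg v).

End free_probability.

Section convolutions.
Variable R : realType.

(* Each convolution is given by its graph: [is_..._mconv m1 m2 nu] says that
   [nu] is the convolution of [m1] and [m2]. *)

Definition is_free_mconv (m1 m2 nu : probability (circle R) R) : Prop :=
  exists (A : star_prob_space R) (u v : A),
    [/\ nc_unitary u /\ nc_unitary v, free_indep u v,
        has_law u m1, has_law v m2 & has_law (u * v) nu].

Definition indep_rv d (T : measurableType d) (P : probability T R)
    (X Y : {RV P >-> circle R}) : Prop :=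
  forall B C : set (circle R), measurable B -> measurable C ->
    P (X @^-1` B `&` Y @^-1` C) = (P (X @^-1` B) * P (Y @^-1` C))%E.

Definition is_classical_mconv (m1 m2 nu : probability (circle R) R) : Prop :=
  exists (d : measure_display) (T : measurableType d) (P : probability T R)
      (X Y : {RV P >-> circle R}),
    [/\ indep_rv X Y,
        same_law (distribution P X) m1, same_law (distribution P Y) m2
      & same_law (pushforward P (fun w => circle_mul (X w) (Y w))) nu].

(* [Ftrans] has a removable singularity at 0, hence [z != 0]. *)
Definition is_boolean_mconv (m1 m2 nu : probability (circle R) R) : Prop :=
  forall z : R[i], `|z| < 1 -> z != 0 -> Ftrans nu z = Ftrans m1 z * Ftrans m2 z.

Definition is_monotone_mconv (m1 m2 nu : probability (circle R) R) : Prop :=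
  forall z : R[i], `|z| < 1 -> chi nu z = chi m1 (chi m2 z).

End convolutions.

(* Main.v *)
(* Let [n] be 2, 3, 4 in the last three cases: [nu] has the moments of the uniform
   law on the [n]-th roots of unity, whereas in the first case it has those of
   the Haar measure.  Take [u] of law [nu] and [v] of law [lambda t], free, and
   work with formal power series in [y].  Put [chi = y^n],
   [e = exp (t/2 * (1 + chi) / (1 - chi))], [U = 1 / (1 - y u)] and
   [V = 1 / (1 - chi e v)].  The states of [U] and [V] are both [1 / (1 - chi)]:
   for [V] this is Lagrange inversion applied to the explicit moments of
   [lambda t].  Hence [a = (1 - chi) U - 1] and [b = ((1 - chi) V - 1) / chi] are
   centered, and an algebraic identity in the style of Haagerup's proof of the
   multiplicativity of the S-transform gives
     [(1 - chi) U (1 - y e u v) V = 1 - a b].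
   Expanding [1 / (1 - a b)], freeness leaves
     [sum_k phi((u v)^k) (y e)^k = 1 / (1 - y^n)],
   and since [e^n] is the series [e] at time [n t], Lagrange inversion identifies
   [phi((u v)^(n k))] with the [k]-th moment of [lambda (n t)].
   Moments determine a law on the circle because indicators of quadrants are
   bounded pointwise limits of polynomials in the two coordinates. *)

Require Import Defs.
From HB Require Import structures.
From mathcomp Require Import all_boot all_order all_algebra.
From mathcomp Require Import all_classical all_reals all_analysis.
From mathcomp Require Import measurable_realfun complex ring lra.

Set Implicit Arguments.
Unset Strict Implicit.
Unset Printing Implicit Defensive.
Import Order.TTheory GRing.Theory Num.Theory.
Import numFieldNormedType.Exports.

Local Open Scope classical_set_scope.
Local Open Scope ring_scope.

(** * Formal power series *)

Definition fps (A : nzRingType) : Type := nat -> A.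

HB.instance Definition _ (A : nzRingType) := gen_eqMixin (fps A).
HB.instance Definition _ (A : nzRingType) := gen_choiceMixin (fps A).

Section FpsRing.
Variable A : nzRingType.
Implicit Types f g h : fps A.

Definition fps_add f g : fps A := fun n => f n + g n.
Definition fps_opp f : fps A := fun n => - f n.
Definition fps_zero : fps A := fun _ => 0.
Definition fps_const (a : A) : fps A := fun n => if n == 0%N then a else 0.
Definition fps_mul f g : fps A := fun n => \sum_(i < n.+1) f i * g (n - i)%N.
Definition fpsX : fps A := fun n => (n == 1%N)%:R.

Fact fps_addA : associative fps_add.
Proof. by move=> f g h; apply/funext => n; rewrite /fps_add addrA. Qed.
Fact fps_addC : commutative fps_add.
Proof. by move=> f g; apply/funext => n; rewrite /fps_add addrC. Qed.
Fact fps_add0 : left_id fps_zero fps_add.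
Proof. by move=> f; apply/funext => n; rewrite /fps_add add0r. Qed.
Fact fps_addN : left_inverse fps_zero fps_opp fps_add.
Proof. by move=> f; apply/funext => n; rewrite /fps_add addNr. Qed.

HB.instance Definition _ := GRing.isZmodule.Build (fps A)
  fps_addA fps_addC fps_add0 fps_addN.

(** Coefficient [n] of a product only sees truncations at a degree [m > n], so associativity,
    commutativity and the Leibniz rule are inherited from [{poly A}]. *)
Lemma fps_mul_poly f g m n : (n < m)%N ->
  fps_mul f g n = ((\poly_(i < m) f i) * (\poly_(i < m) g i))`_n.
Proof.
move=> nm; rewrite coefM; apply: eq_bigr => i _.
have im : (i < m)%N by exact: leq_trans (ltn_ord i) nm.
by rewrite !coef_poly im (leq_ltn_trans (leq_subr _ _) nm).
Qed.

Lemma fps_mul_polyl (p : {poly A}) g m n : (n < m)%N ->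
  fps_mul (fun i => p`_i) g n = (p * (\poly_(i < m) g i))`_n.
Proof.
move=> nm; rewrite coefM; apply: eq_bigr => i _.
by rewrite coef_poly (leq_ltn_trans (leq_subr _ _) nm).
Qed.

Lemma fps_mul_polyr f (q : {poly A}) m n : (n < m)%N ->
  fps_mul f (fun i => q`_i) n = ((\poly_(i < m) f i) * q)`_n.
Proof.
move=> nm; rewrite coefM; apply: eq_bigr => i _.
by rewrite coef_poly (leq_trans (ltn_ord i) nm).
Qed.

Fact fps_mulA : associative fps_mul.
Proof.
move=> f g h; apply/funext => n.
pose t k := \poly_(i < n.+1) (k i : A).
transitivity ((t f * (t g * t h))`_n).
  rewrite -(fps_mul_polyr _ _ (ltnSn n)) /fps_mul; apply: eq_bigr => i _.
  by congr (_ * _); apply: fps_mul_poly; rewrite ltnS leq_subr.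
rewrite mulrA -(fps_mul_polyl _ _ (ltnSn n)) /fps_mul; apply: eq_bigr => i _.
by congr (_ * _); symmetry; apply: fps_mul_poly.
Qed.

Fact fps_mul1 : left_id (fps_const 1) fps_mul.
Proof.
move=> f; apply/funext => n; rewrite /fps_mul big_ord_recl /= mul1r subn0.
by rewrite big1 ?addr0 // => i _; rewrite /fps_const /= mul0r.
Qed.
Fact fps_mulr1 : right_id (fps_const 1) fps_mul.
Proof.
move=> f; apply/funext => n; rewrite /fps_mul big_ord_recr /= subnn mulr1.
rewrite big1 ?add0r // => i _.
by rewrite /fps_const subn_eq0 leqNgt ltn_ord /= mulr0.
Qed.
Fact fps_mulDl : left_distributive fps_mul fps_add.
Proof.
move=> f g h; apply/funext => n; rewrite /fps_mul /fps_add -big_split /=.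
by apply: eq_bigr => i _; rewrite mulrDl.
Qed.
Fact fps_mulDr : right_distributive fps_mul fps_add.
Proof.
move=> f g h; apply/funext => n; rewrite /fps_mul /fps_add -big_split /=.
by apply: eq_bigr => i _; rewrite mulrDr.
Qed.
Fact fps_one_neq0 : fps_const 1 != 0.
Proof.
by apply/eqP => /(congr1 (fun f : fps A => f 0%N)) /eqP; rewrite /= oner_eq0.
Qed.

HB.instance Definition _ := GRing.Zmodule_isNzRing.Build (fps A)
  fps_mulA fps_mul1 fps_mulr1 fps_mulDl fps_mulDr fps_one_neq0.

Lemma fpsP f g : (forall n, f n = g n) -> f = g.
Proof. by move=> e; apply/funext. Qed.

Lemma fcoef1 n : (1 : fps A) n = (n == 0%N)%:R.
Proof. by rewrite /1%R /= /fps_const; case: eqP. Qed.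
Lemma fcoefD f g n : (f + g) n = f n + g n. Proof. by []. Qed.
Lemma fcoefN f n : (- f) n = - f n. Proof. by []. Qed.
Lemma fcoefB f g n : (f - g) n = f n - g n. Proof. by []. Qed.
Lemma fcoefM f g n : (f * g) n = \sum_(i < n.+1) f i * g (n - i)%N.
Proof. by []. Qed.

Lemma fcoefCM a f n : (fps_const a * f) n = a * f n.
Proof.
rewrite fcoefM big_ord_recl subn0 /= big1 ?addr0 // => i _.
by rewrite /fps_const /= mul0r.
Qed.

Lemma fcoefMC a f n : (f * fps_const a) n = f n * a.
Proof.
rewrite fcoefM big_ord_recr subnn /= big1 ?add0r // => i _.
by rewrite /fps_const subn_eq0 leqNgt ltn_ord /= mulr0.
Qed.

Lemma fcoefXM f n : (fpsX * f) n = if n is m.+1 then f m else 0.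
Proof.
case: n => [|n]; first by rewrite fcoefM big_ord1 /= mul0r.
rewrite fcoefM 2!big_ord_recl /= mul0r add0r mul1r subSS subn0 big1 ?addr0 //.
by move=> i _; rewrite /fpsX /= mul0r.
Qed.

Lemma fcoefXnM k f n : (fpsX ^+ k * f) n = if (k <= n)%N then f (n - k)%N else 0.
Proof.
elim: k n => [|k IH] n; first by rewrite expr0 mul1r subn0.
by rewrite exprS -mulrA fcoefXM; case: n => // n; rewrite IH subSS.
Qed.

Lemma fcoef0M f g : (f * g) 0%N = f 0%N * g 0%N.
Proof. by rewrite fcoefM big_ord1. Qed.

Lemma fcoef0X f k : (f ^+ k) 0%N = f 0%N ^+ k.
Proof. by elim: k => [|k IH]; rewrite ?expr0 ?fcoef1 // !exprS fcoef0M IH. Qed.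

Fact fps_const_is_zmod_morphism : zmod_morphism fps_const.
Proof. by move=> a b; apply/fpsP => -[|n] //; rewrite fcoefB /fps_const /= subr0. Qed.
Fact fps_const_is_monoid_morphism : monoid_morphism fps_const.
Proof.
split=> [|a b]; apply/fpsP => n; first by rewrite fcoef1 /fps_const; case: eqP.
by rewrite fcoefCM /fps_const; case: eqP; rewrite ?mulr0.
Qed.
HB.instance Definition _ := GRing.isZmodMorphism.Build A (fps A) fps_const
  fps_const_is_zmod_morphism.
HB.instance Definition _ := GRing.isMonoidMorphism.Build A (fps A) fps_const
  fps_const_is_monoid_morphism.

Lemma fps_eta f : f = fps_const (f 0%N) + fpsX * (fun n => f n.+1 : A).
Proof.
by apply/fpsP => -[|n]; rewrite fcoefD fcoefXM /fps_const /= ?addr0 ?add0r.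
Qed.

(** The X-adic order is at least [m]; infinite sums of series are cut to finite ones through
    this. *)
Definition vanish m f := forall i, (i < m)%N -> f i = 0.

Lemma vanishM m k f g : vanish m f -> vanish k g -> vanish (m + k) (f * g).
Proof.
move=> vf vg i im; rewrite fcoefM big1 // => j _.
have [jm|mj] := ltnP j m; first by rewrite vf ?mul0r.
rewrite vg ?mulr0 // ltn_subLR; last by rewrite -ltnS.
by apply: leq_trans im _; rewrite leq_add2r.
Qed.

Lemma vanishX k f : f 0%N = 0 -> vanish k (f ^+ k).
Proof.
move=> f0; elim: k => [|k IH]; first by [].
by rewrite exprS -add1n; apply: vanishM => // -[|[]].
Qed.

Lemma vanishMr m f g : vanish m f -> vanish m (f * g).
Proof. by move=> vf; rewrite -[m]addn0; apply: vanishM. Qed.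

End FpsRing.
Arguments fpsX {A}.

Section FpsCom.
Variable K : comNzRingType.
Fact fps_mulC : commutative (@fps_mul K).
Proof.
move=> f g; apply/funext => n; rewrite !(fps_mul_poly _ _ (ltnSn n)).
by rewrite mulrC.
Qed.
HB.instance Definition _ :=
  GRing.PzRing_hasCommutativeMul.Build (fps K) fps_mulC.
End FpsCom.

(** * Composition and derivation of formal power series *)

Section FpsComp.
Variable K : comNzRingType.
Implicit Types c d f g h : fps K.

Definition fps_shift (A : nzRingType) (c : fps A) : fps A := fun n => c n.+1.

(* Meaningful only when [g 0 = 0]. *)
Definition fps_comp c g : fps K := fun n => \sum_(k < n.+1) c k * (g ^+ k) n.

(** [g ^+ k] has order at least [k], so the terms past [n] contribute zero to coefficient [n]. *)
Lemma fps_comp_wide c g n m : g 0%N = 0 -> (n <= m)%N ->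
  fps_comp c g n = \sum_(k < m.+1) c k * (g ^+ k) n.
Proof.
move=> g0 nm; rewrite /fps_comp (big_ord_widen m.+1 (fun k => c k * (g ^+ k) n)) //.
rewrite big_mkcond /=; apply: eq_bigr => k _; case: ltnP => // nk.
by rewrite (@vanishX _ k g) ?mulr0.
Qed.

(** Horner's rule. Together with [fps_coind] it gives multiplicativity, associativity and the chain
    rule: the defect of each identity satisfies the recursion of that lemma. *)
Lemma fps_comp_rec c g : g 0%N = 0 ->
  fps_comp c g = fps_const (c 0%N) + g * fps_comp (fps_shift c) g.
Proof.
move=> g0; apply/fpsP => n.
rewrite (fps_comp_wide c g0 (leqnSn n)) big_ord_recl expr0 fcoefD fcoef1.
congr (_ + _); first by rewrite /fps_const; case: (n == 0)%N; rewrite ?mulr1 ?mulr0.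
rewrite fcoefM; under [in RHS]eq_bigr => i _.
  rewrite (fps_comp_wide (fps_shift c) g0 (leq_subr i n)) big_distrr /=.
  over.
rewrite exchange_big /=; apply: eq_bigr => k _.
rewrite exprS fcoefM big_distrr /=; apply: eq_bigr => i _.
by rewrite mulrCA.
Qed.

Lemma fcoefM_comp f c g n : g 0%N = 0 ->
  (f * fps_comp c g) n = \sum_(j < n.+1) c j * (f * g ^+ j) n.
Proof.
move=> g0; rewrite fcoefM; under eq_bigr => i _.
  rewrite (fps_comp_wide _ g0 (leq_subr i n)) mulr_sumr.
  over.
rewrite exchange_big /=; apply: eq_bigr => j _.
by rewrite fcoefM mulr_sumr; apply: eq_bigr => i _; rewrite mulrCA.
Qed.

(* The recursion [d c = g * d (fps_shift c)] forces [d c = 0], as [g] has no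
   constant term. *)
Lemma fps_coind (d : fps K -> fps K) g : g 0%N = 0 ->
  (forall c, d c = g * d (fps_shift c)) -> forall c, d c = 0.
Proof.
move=> g0 dE c; apply/fpsP => n; elim/ltn_ind: n c => n IH c.
rewrite dE fcoefM big_ord_recl g0 mul0r add0r big1 // => i _.
rewrite lift0 IH ?mulr0 // ltn_subrL /=; exact: leq_ltn_trans (ltn_ord i).
Qed.

Lemma fps_comp0 c g : fps_comp c g 0%N = c 0%N.
Proof. by rewrite /fps_comp big_ord1 expr0 fcoef1 mulr1. Qed.

Lemma fps_compD c d g : fps_comp (c + d) g = fps_comp c g + fps_comp d g.
Proof.
apply/fpsP => n; rewrite fcoefD /fps_comp -big_split.
by apply: eq_bigr => i _; rewrite fcoefD mulrDl.
Qed.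

Lemma fps_compC a g : g 0%N = 0 -> fps_comp (fps_const a) g = fps_const a.
Proof.
move=> g0; apply/fpsP => n; rewrite /fps_comp big_ord_recl expr0 fcoef1.
rewrite big1 ?addr0; last by move=> i _; rewrite /fps_const mul0r.
by rewrite /fps_const; case: (n == 0)%N; rewrite ?mulr1 ?mulr0.
Qed.

Lemma fps_comp1 g : g 0%N = 0 -> fps_comp 1 g = 1.
Proof. by move=> g0; rewrite -[1](rmorph1 (@fps_const K)) fps_compC. Qed.

Lemma fps_compX g : g 0%N = 0 -> fps_comp fpsX g = g.
Proof.
move=> g0; have sX : fps_shift fpsX = fps_const 1 :> fps K by apply/fpsP => -[|n].
by rewrite fps_comp_rec // sX fps_compC // raddf0 rmorph1 add0r mulr1.
Qed.

Lemma fps_compM c d g : g 0%N = 0 ->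
  fps_comp (c * d) g = fps_comp c g * fps_comp d g.
Proof.
move=> g0; apply/eqP; rewrite -subr_eq0; apply/eqP.
pose D c := fps_comp (c * d) g - fps_comp c g * fps_comp d g.
apply: (@fps_coind D g g0) => {}c; rewrite /D.
(* Splitting [c] as [c 0 + X * fps_shift c] leads to [D c = g * D (fps_shift c)]. *)
have -> : fps_comp (c * d) g =
    fps_const (c 0%N) * fps_comp d g + g * fps_comp (fps_shift c * d) g.
  rewrite {1}[c]fps_eta mulrDl fps_compD -mulrA; congr (_ + _).
    apply/fpsP => n; rewrite fcoefCM /fps_comp big_distrr /=.
    by apply: eq_bigr => i _; rewrite fcoefCM mulrA.
  rewrite fps_comp_rec // fcoefXM raddf0 add0r; congr (_ * fps_comp _ _).
  by apply/fpsP => n; rewrite /fps_shift fcoefXM.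
by rewrite (fps_comp_rec c) //; ring.
Qed.

Lemma fps_compXn c g k : g 0%N = 0 -> fps_comp (c ^+ k) g = fps_comp c g ^+ k.
Proof.
move=> g0; elim: k => [|k IH]; last by rewrite !exprS fps_compM // IH.
by rewrite !expr0 -(rmorph1 (@fps_const K)) fps_compC.
Qed.

Lemma fps_compA c g h : g 0%N = 0 -> h 0%N = 0 ->
  fps_comp (fps_comp c g) h = fps_comp c (fps_comp g h).
Proof.
move=> g0 h0; have gh0 : fps_comp g h 0%N = 0 by rewrite fps_comp0.
apply/eqP; rewrite -subr_eq0; apply/eqP.
pose D c := fps_comp (fps_comp c g) h - fps_comp c (fps_comp g h).
apply: (@fps_coind D _ gh0) => {}c; rewrite /D.
rewrite (fps_comp_rec c) // fps_compD fps_compM // fps_compC //.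
by rewrite (fps_comp_rec c gh0); ring.
Qed.

Definition fps_deriv f : fps K := fun n => f n.+1 *+ n.+1.

Lemma fps_derivD f g : fps_deriv (f + g) = fps_deriv f + fps_deriv g.
Proof. by apply/fpsP => n; rewrite /fps_deriv !fcoefD mulrnDl. Qed.

Lemma fps_derivC a : fps_deriv (fps_const a) = 0.
Proof. by apply/fpsP => n; rewrite /fps_deriv /fps_const mul0rn. Qed.

Lemma fps_derivM f g : fps_deriv (f * g) = fps_deriv f * g + f * fps_deriv g.
Proof.
apply/fpsP => n; rewrite fcoefD.
pose t (k : fps K) := \poly_(i < n.+2) k i.
have tD (k : fps K) i : (i < n.+1)%N -> (t k)^`()`_i = fps_deriv k i.
  by move=> im; rewrite coef_deriv coef_poly ltnS im.
have tE (k : fps K) i : (i < n.+2)%N -> (t k)`_i = k i.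
  by move=> im; rewrite coef_poly im.
transitivity ((t f * t g)^`()`_n).
  by rewrite coef_deriv /fps_deriv [(f * g) _](fps_mul_poly _ _ (ltnSn _)).
rewrite derivM coefD !coefM.
have le_i (i : 'I_n.+1) : (i < n.+1)%N * (n - i < n.+1)%N.
  by rewrite ltn_ord ltnS leq_subr.
by congr (_ + _); rewrite fcoefM; apply: eq_bigr => i _;
  rewrite tD ?tE // ?le_i // ltnW // ltnS le_i.
Qed.

Lemma fps_derivX : fps_deriv (@fpsX K) = 1.
Proof. by apply/fpsP => -[|n]; rewrite /fps_deriv fcoef1 /fpsX ?mul0rn. Qed.

Lemma fps_derivXn f k : fps_deriv (f ^+ k.+1) = fps_deriv f * f ^+ k *+ k.+1.
Proof.
elim: k => [|k IH]; first by rewrite expr1 expr0 mulr1.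
by rewrite exprS fps_derivM IH mulrnAr [in RHS]mulrS !exprS; ring.
Qed.

Lemma fps_deriv_comp c g : g 0%N = 0 ->
  fps_deriv (fps_comp c g) = fps_deriv g * fps_comp (fps_deriv c) g.
Proof.
move=> g0; apply/eqP; rewrite -subr_eq0; apply/eqP.
pose D c := fps_deriv (fps_comp c g) - fps_deriv g * fps_comp (fps_deriv c) g.
apply: (@fps_coind D g g0) => {}c; rewrite /D.
rewrite (fps_comp_rec c) // fps_derivD fps_derivC add0r fps_derivM.
rewrite {3}[c]fps_eta fps_derivD fps_derivC add0r fps_derivM fps_derivX mul1r.
rewrite fps_compD fps_compM // fps_compX //; rewrite -/(fps_shift c); ring.
Qed.
End FpsComp.

(** * Lagrange inversion *)

Section Lagrange.
Variable K : numFieldType.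
Implicit Types c f g L : fps K.

(** With [W = X * Theta] this is the residue of [W' / W^(r+1)], an exact derivative unless
    [r = 0]. *)
Lemma fps_lagrange_unit (Theta Phi : fps K) r : Phi * Theta = 1 ->
  (Phi ^+ r.+1 * fps_deriv (fpsX * Theta)) r = (r == 0%N)%:R.
Proof.
move=> PT; rewrite fps_derivM fps_derivX mul1r mulrDr.
have e1 : Phi ^+ r.+1 * Theta = Phi ^+ r.
  by rewrite exprSr -mulrA PT mulr1.
case: r e1 => [|r] e1.
  by rewrite e1 fcoefD mulrCA fcoefXM expr0 fcoef1 addr0.
rewrite e1 fcoefD mulrCA fcoefXM.
have dT : Phi * fps_deriv Theta = - (Theta * fps_deriv Phi).
  apply/eqP; rewrite -addr_eq0 addrC mulrC -fps_derivM PT.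
  by rewrite -(rmorph1 (@fps_const K)) fps_derivC.
have -> : Phi ^+ r.+2 * fps_deriv Theta = - (fps_deriv Phi * Phi ^+ r).
  rewrite exprSr -mulrA dT mulrN; congr (- _).
  by rewrite exprSr -mulrA [Phi * _]mulrA PT mul1r mulrC.
(* [(r+1) [X^(r+1)] Phi^(r+1)] is the coefficient of [X^r] in the derivative of [Phi^(r+1)];
   dividing by [r+1] uses characteristic zero. *)
have /(congr1 (fun f : fps K => f r)) := fps_derivXn Phi r.
have -> k f : (f *+ k) r = f r *+ k.
  by elim: k => // k IH; rewrite !mulrS fcoefD IH.
rewrite {1}/fps_deriv => /eqP; rewrite eqr_pMn2r // => /eqP ->.
by rewrite fcoefN subrr.
Qed.

(* Lagrange's formula [k c_k = [X^(k-1)] H' Phi^k] for [H = sum_k c_k (X Theta)^k]. *)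
Lemma fps_lagrange (Theta Phi : fps K) c k : Phi * Theta = 1 ->
  (fps_deriv (fps_comp c (fpsX * Theta)) * Phi ^+ k.+1) k = c k.+1 *+ k.+1.
Proof.
move=> PT; have W0 : (fpsX * Theta) 0%N = 0 by rewrite fcoefXM.
rewrite fps_deriv_comp // mulrAC mulrC [fps_deriv _ * _]mulrC.
set Q := Phi ^+ _ * _.
(* Orthogonality: [i] factors [Phi] cancel [Theta ^+ i], and [fps_lagrange_unit] with [r = k - i]
   leaves only [i = k]. *)
have coefQ (i : 'I_k.+1) :
    (Q * (fpsX * Theta) ^+ i) k = (val i == k)%:R.
  rewrite exprMn mulrCA fcoefXnM -ltnS ltn_ord.
  have -> : Q * Theta ^+ i = Phi ^+ (k - i).+1 * fps_deriv (fpsX * Theta).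
    rewrite /Q mulrAC; congr (_ * _).
    have {1}-> : k.+1 = ((k - i).+1 + i)%N by rewrite addSn subnK // -ltnS.
    by rewrite exprD -mulrA -exprMn PT expr1n mulr1.
  rewrite fps_lagrange_unit //.
  have ik : (i <= k)%N by rewrite -ltnS.
  by rewrite subn_eq0 eqn_leq ik.
have -> : (fps_comp (fps_deriv c) (fpsX * Theta) * Q) k =
    \sum_(i < k.+1) fps_deriv c i * (Q * (fpsX * Theta) ^+ i) k.
  rewrite mulrC fcoefM_comp //.
rewrite (bigD1 ord_max) // (coefQ ord_max) eqxx mulr1 big1 => [|i ik].
  exact: addr0.
by rewrite coefQ (_ : val i == k = false) ?mulr0 //; apply/negbTE.
Qed.

(** Converse of Lagrange's formula. The difference of the two sides has a derivative [L] with [[X^k]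
    (L * Phi^(k+1)) = 0] for all [k]; as [Phi 0 != 0], this system is triangular and [L = 0]. *)
Lemma fps_lagrange_inversion (Theta Phi H : fps K) c : Phi * Theta = 1 ->
  c 0%N = H 0%N ->
  (forall k, c k.+1 *+ k.+1 = (fps_deriv H * Phi ^+ k.+1) k) ->
  fps_comp c (fpsX * Theta) = H.
Proof.
move=> PT c0 cE; pose L := fps_deriv (fps_comp c (fpsX * Theta) - H).
have LP k : (L * Phi ^+ k.+1) k = 0.
  have -> : L = fps_deriv (fps_comp c (fpsX * Theta)) - fps_deriv H.
    by apply/fpsP => n; rewrite /L /fps_deriv !fcoefB mulrnBl.
  by rewrite mulrBl fcoefB fps_lagrange // cE subrr.
have P0 : Phi 0%N != 0.
  have /eqP := congr1 (fun f : fps K => f 0%N) PT.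
  by rewrite fcoef0M fcoef1; apply: contraTneq => ->; rewrite mul0r eq_sym oner_eq0.
have L0 k : L k = 0.
  elim/ltn_ind: k => k IH; move: (LP k).
  rewrite fcoefM big_ord_recr /= subnn fcoef0X big1 ?add0r; last first.
    by move=> i _; rewrite IH ?mul0r.
  by move/eqP; rewrite mulf_eq0 expf_eq0 (negbTE P0) andbF orbF => /eqP.
apply/eqP; rewrite -subr_eq0; apply/eqP/fpsP => -[|n].
  by rewrite fcoefB fps_comp0 c0 subrr.
by apply/eqP; move: (L0 n) => /eqP; rewrite /L /fps_deriv mulrn_eq0.
Qed.

(** [g] has order exactly one, so the coefficients solve a triangular system with diagonal entries
    [g 1 ^+ n]. *)
Lemma fps_comp_inj c d g : g 0%N = 0 -> g 1%N != 0 ->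
  fps_comp c g = fps_comp d g -> c = d.
Proof.
move=> g0 g1 cd; apply/fpsP => n; elim/ltn_ind: n => n IH.
have gn : (g ^+ n) n != 0.
  have -> : g = fpsX * fps_shift g by rewrite {1}[g]fps_eta g0 raddf0 add0r.
  by rewrite exprMn fcoefXnM leqnn subnn fcoef0X expf_neq0.
have /eqP := congr1 (fun f : fps K => f n) cd.
rewrite /fps_comp !big_ord_recr /=.
under eq_bigr => i _ do rewrite IH //.
by rewrite (inj_eq (addrI _)) (inj_eq (mulIf gn)) => /eqP.
Qed.
End Lagrange.

(** * Moment series of the free unitary Brownian motion *)

Section UbmSeries.
Variable K : numFieldType.
Implicit Types (s T : K) (n k : nat).

Definition geom : fps K := fun=> 1.

Lemma geomP : (1 - fpsX) * geom = 1.
Proof.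
apply/fpsP => -[|n]; rewrite mulrBl mul1r fcoefB fcoefXM fcoef1 /geom.
  by rewrite subr0.
by rewrite subrr.
Qed.

(** Multiplying by [geom] takes partial sums, so this is the hockey-stick identity. *)
Lemma fcoef_geomX j n : (geom ^+ j.+1) n = 'C(n + j, j)%:R.
Proof.
elim: j n => [|j IH] n; first by rewrite expr1 bin0.
rewrite exprSr fcoefM.
under eq_bigr => i _ do rewrite IH mulr1.
elim: n => [|n IHn]; first by rewrite big_ord1 !binn.
by rewrite big_ord_recr /= IHn [in RHS]addSn binS natrD addSnnS.
Qed.

Lemma deriv_geom : fps_deriv geom = geom ^+ 2.
Proof. by apply/fpsP => n; rewrite fcoef_geomX bin1 addn1. Qed.

(** The series [exp (c * X / (1 - X))]. *)
Definition expXG c : fps K :=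
  fps_comp (fun j => c ^+ j / j`!%:R) (fpsX * geom).

Let XG0 : (fpsX * geom) 0%N = 0. Proof. by rewrite fcoefXM. Qed.

Lemma expXG0 : expXG 0 = 1.
Proof.
rewrite /expXG -(rmorph1 (@fps_const K)) -[RHS](fps_compC 1 XG0).
by congr fps_comp; apply/fpsP => -[|n]; rewrite /fps_const /= expr0n ?mul0r ?divr1.
Qed.

Lemma expXGD c d : expXG c * expXG d = expXG (c + d).
Proof.
rewrite /expXG -fps_compM //; congr fps_comp; apply/fpsP => n.
rewrite fcoefM exprDn mulr_suml (reindex_inj rev_ord_inj) /=.
apply: eq_bigr => i _; rewrite subSS (subKn (ltn_ord i : (i <= n)%N)).
have nz k : k`!%:R != 0 :> K by rewrite pnatr_eq0 -lt0n fact_gt0.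
rewrite -(bin_fact (ltn_ord i : (i <= n)%N)) !natrM -mulr_natr.
have bz : 'C(n, i)%:R != 0 :> K by rewrite pnatr_eq0 -lt0n bin_gt0 -ltnS.
by field; rewrite bz !nz.
Qed.

Lemma expXG_X c n : expXG c ^+ n = expXG (n%:R * c).
Proof.
elim: n => [|n IH]; first by rewrite expr0 mul0r expXG0.
by rewrite exprS IH expXGD -natr1 mulrDl mul1r addrC.
Qed.

(** As [geom ^+ 2] is the derivative of [geom], these are the coefficients that Lagrange's formula
    calls for when [H = geom]. *)
Lemma fcoef_geom2_expXG c k :
  (geom ^+ 2 * expXG c) k = \sum_(j < k.+1) c ^+ j / j`!%:R * 'C(k.+1, j.+1)%:R.
Proof.
rewrite fcoefM_comp //; apply: eq_bigr => j _; congr (_ * _).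
rewrite exprMn mulrCA fcoefXnM -ltnS ltn_ord -exprD !addSn add0n fcoef_geomX.
by rewrite addnS subnK // -ltnS.
Qed.

(** For [s = exp (T / 2)] this is the Sigma-transform [exp (T/2 * (1 + X) / (1 - X))], because
    [(1 + X) / (1 - X) = 1 + 2 * X / (1 - X)]. The factor [s] is a parameter of its own since a
    general [K] has no exponential. *)
Definition ubm_theta s T : fps K := fps_const s * expXG T.

(* With [s = exp (T / 2)], the moments of the free unitary Brownian motion at
   time [T]. *)
Definition ubm_coef s T : fps K := fun k =>
  if k == 0%N then 1 else
  s ^- k * \sum_(j < k) ((- T) ^+ j / j`!%:R * 'C(k, j.+1)%:R * (k%:R ^+ j / k%:R)).

(** Lagrange inversion with [H = geom]: the inverse of [ubm_theta s T] has the same shape, with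
    parameters [s^-1] and [- T]. *)
Lemma ubm_series s T : s != 0 ->
  fps_comp (ubm_coef s T) (fpsX * ubm_theta s T) = geom.
Proof.
move=> s0; apply: (@fps_lagrange_inversion _ _ (ubm_theta s^-1 (- T))) => // [|k].
  rewrite /ubm_theta mulrACA -rmorphM mulVf // expXGD addNr expXG0 rmorph1.
  by rewrite mulr1.
rewrite deriv_geom /ubm_theta exprMn expXG_X -rmorphXn mulrCA fcoefCM.
rewrite fcoef_geom2_expXG /ubm_coef /= exprVn -mulrnAr -sumrMnl; congr (_ * _).
apply: eq_bigr => j _; rewrite -mulr_natr exprMn.
have kz : k.+1%:R != 0 :> K by rewrite pnatr_eq0.
have nz : j`!%:R != 0 :> K by rewrite pnatr_eq0 -lt0n fact_gt0.
by field; rewrite nz addrC natr1 kz.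
Qed.

Section Substitution.
Variables (n : nat) (s T : K).
Hypotheses (n_gt0 : (0 < n)%N) (s_neq0 : s != 0).

(** The series [1 / (1 - X^n)], generating the moments of the uniform law on the [n]-th roots of
    unity. *)
Definition rootgeom : fps K := fps_comp geom (fpsX ^+ n).
Definition ubm_e : fps K := fps_comp (ubm_theta s T) (fpsX ^+ n).

Let Xn0 : (fpsX ^+ n : fps K) 0%N = 0.
Proof. by rewrite fcoef0X expr0n gtn_eqF. Qed.

Let XM0 (f : fps K) : (fpsX * f) 0%N = 0. Proof. by rewrite fcoefXM. Qed.

Lemma rootgeomP : (1 - fpsX ^+ n) * rootgeom = 1.
Proof.
have -> : 1 - fpsX ^+ n = fps_comp (1 - fpsX) (fpsX ^+ n) :> fps K.
  apply/eqP; rewrite subr_eq -{2}(fps_compX Xn0) -fps_compD subrK.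
  by rewrite fps_comp1.
by rewrite -fps_compM // geomP fps_comp1.
Qed.

Lemma fcoef_comp_Xn (c : fps K) k :
  fps_comp c (fpsX ^+ n) k = if (n %| k)%N then c (k %/ n)%N else 0.
Proof.
have XnE (j : 'I_k.+1) : ((fpsX ^+ n) ^+ j : fps K) k = (k == n * j)%N%:R.
  rewrite -exprM -[_ ^+ _]mulr1 fcoefXnM fcoef1 subn_eq0 eqn_leq.
  by case: leqP; rewrite ?andbT ?andbF.
rewrite /fps_comp; under eq_bigr => j _ do rewrite XnE.
have [/dvdnP[q ->]|ndvd] := boolP (n %| k)%N; last first.
  rewrite big1 // => j _; case: eqP => [kE|]; rewrite ?mulr0 //.
  by rewrite kE dvdn_mulr in ndvd.
rewrite mulnK //.
have qk : (q < (q * n).+1)%N by rewrite ltnS leq_pmulr.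
have qE j : (q * n == n * j)%N = (j == q).
  by rewrite mulnC eqn_pmul2l // eq_sym.
rewrite (bigD1 (Ordinal qk)) //= qE eqxx mulr1 big1 ?addr0 // => j.
by rewrite -val_eqE /= qE => /negbTE ->; rewrite mulr0.
Qed.

(** Substitution of [X^n] in [ubm_series]; in this form the law of the Brownian motion enters the
    free product. *)
Lemma ubm_series_omega :
  fps_comp (ubm_coef s T) (fpsX ^+ n * ubm_e) = rootgeom.
Proof.
rewrite /rootgeom -(ubm_series T s_neq0) fps_compA //; congr fps_comp.
by rewrite fps_compM // fps_compX.
Qed.

(** [ubm_e ^+ n] is the Sigma-transform for [s ^+ n] and [n * T] taken at [X^n], so the claimed
    value of [p] also gives [1 / (1 - X^n)] when composed with [X * ubm_e]. The latter has linear
    coefficient [s != 0], hence composition with it is injective. *)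
Lemma ubm_series_root (p : fps K) : fps_comp p (fpsX * ubm_e) = rootgeom ->
  p = fps_comp (ubm_coef (s ^+ n) (n%:R * T)) (fpsX ^+ n).
Proof.
move=> pE; apply: (@fps_comp_inj _ _ _ (fpsX * ubm_e)) => //.
  rewrite fcoefXM /ubm_e fps_comp0 /ubm_theta fcoef0M /expXG fps_comp0.
  by rewrite expr0 divr1 mulr1.
rewrite pE (fps_compA _ Xn0 (XM0 _)) (fps_compXn _ _ (XM0 _)).
rewrite (fps_compX (XM0 _)) exprMn.
rewrite /rootgeom -(ubm_series (n%:R * T) (expf_neq0 n s_neq0)) fps_compA //.
congr fps_comp; rewrite fps_compM // fps_compX //; congr (_ * _).
by rewrite /ubm_e -fps_compXn // /ubm_theta exprMn expXG_X rmorphXn.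
Qed.

End Substitution.
End UbmSeries.

(** * Free products *)

Section FpsAlg.
Variables (K : comNzRingType) (A : algType K).
Implicit Types (f g : fps K) (p q : fps A) (a : A).

Definition fps_alg f : fps A := fun n => (f n)%:A.

Lemma fcoef_algM f p n : (fps_alg f * p) n = \sum_(i < n.+1) f i *: p (n - i)%N.
Proof. by rewrite fcoefM; apply: eq_bigr => i _; rewrite mulr_algl. Qed.

Fact fps_alg_is_zmod_morphism : zmod_morphism fps_alg.
Proof. by move=> f g; apply/fpsP => n; rewrite /fps_alg !fcoefB scalerBl. Qed.
Fact fps_alg_is_monoid_morphism : monoid_morphism fps_alg.
Proof.
split=> [|f g]; apply/fpsP => n; first by rewrite /fps_alg !fcoef1 scaler_nat.
rewrite fcoef_algM /fps_alg fcoefM scaler_suml; apply: eq_bigr => i _.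
by rewrite scalerA.
Qed.
HB.instance Definition _ := GRing.isZmodMorphism.Build (fps K) (fps A) fps_alg
  fps_alg_is_zmod_morphism.
HB.instance Definition _ := GRing.isMonoidMorphism.Build (fps K) (fps A) fps_alg
  fps_alg_is_monoid_morphism.

Lemma fps_algC f p : fps_alg f * p = p * fps_alg f.
Proof.
apply/fpsP => n; rewrite fcoef_algM fcoefM (reindex_inj rev_ord_inj) /=.
apply: eq_bigr => i _; rewrite subSS subKn; last by rewrite -ltnS.
by rewrite mulr_algr.
Qed.

(* The geometric series of [g a], meaningful only when [g 0 = 0]. *)
Definition resolv g a : fps A := fun n => \sum_(k < n.+1) (g ^+ k) n *: a ^+ k.

Lemma resolv_wide g a n m : g 0%N = 0 -> (n <= m)%N ->
  resolv g a n = \sum_(k < m.+1) (g ^+ k) n *: a ^+ k.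
Proof.
move=> g0 nm; rewrite /resolv (big_ord_widen m.+1 (fun k => (g ^+ k) n *: a ^+ k)) //.
rewrite big_mkcond /=; apply: eq_bigr => k _; case: ltnP => // nk.
by rewrite (@vanishX _ k g) ?scale0r.
Qed.

Lemma resolvCl g a : fps_const a * resolv g a = resolv g a * fps_const a.
Proof.
apply/fpsP => n; rewrite fcoefCM fcoefMC /resolv mulr_sumr mulr_suml.
by apply: eq_bigr => k _; rewrite -scalerAl -scalerAr -exprS -exprSr.
Qed.

Lemma resolv_rec g a : g 0%N = 0 ->
  resolv g a = 1 + fps_alg g * (resolv g a * fps_const a).
Proof.
move=> g0; apply/fpsP => n.
rewrite (resolv_wide a g0 (leqnSn n)) big_ord_recl expr0 fcoefD !fcoef1.
congr (_ + _); first by rewrite expr0 scaler_nat.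
rewrite fcoef_algM; under [in RHS]eq_bigr => i _.
  rewrite fcoefMC (resolv_wide a g0 (leq_subr i n)) mulr_suml scaler_sumr.
  over.
rewrite exchange_big /=; apply: eq_bigr => k _.
rewrite exprS fcoefM scaler_suml; apply: eq_bigr => i _.
by rewrite -scalerAl scalerA exprSr.
Qed.

Variable phi : {scalar A}.

Definition fps_state p : fps K := fun n => phi (p n).

Fact fps_state_is_zmod_morphism : zmod_morphism fps_state.
Proof. by move=> p q; apply/fpsP => n; rewrite /fps_state !fcoefB raddfB. Qed.
HB.instance Definition _ := GRing.isZmodMorphism.Build (fps A) (fps K) fps_state
  fps_state_is_zmod_morphism.

Lemma fps_stateZ f p : fps_state (fps_alg f * p) = f * fps_state p.
Proof.
apply/fpsP => n; rewrite /fps_state fcoef_algM raddf_sum fcoefM.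
by apply: eq_bigr => i _; exact: scalarZ.
Qed.

Lemma fps_state_resolv g a :
  fps_state (resolv g a) = fps_comp (fun k => phi (a ^+ k)) g.
Proof.
apply/fpsP => n; rewrite /fps_state /resolv raddf_sum; apply: eq_bigr => k _.
by rewrite [LHS]scalarZ mulrC.
Qed.

Lemma fps_state1 : phi 1 = 1 -> fps_state 1 = 1.
Proof.
move=> phi1; apply/fpsP => n; rewrite /fps_state !fcoef1.
by case: (n == 0)%N; rewrite ?phi1 ?raddf0.
Qed.

End FpsAlg.

(** * Moments of products of free elements *)

Section FreeProduct.
Variables (K : numFieldType) (A : algType K) (phi : {scalar A}).
Variable B : bool -> A -> Prop.
Hypothesis phi1 : phi 1 = 1.
Hypothesis B1 : forall b, B b 1.
Hypothesis Blin : forall b c x y, B b x -> B b y -> B b (c *: x + y).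
Hypothesis BM : forall b x y, B b x -> B b y -> B b (x * y).
Hypothesis free : forall s : seq (bool * A), s != [::] ->
  sorted (fun p q => p.1 != q.1) s ->
  (forall p, p \in s -> B p.1 p.2 /\ phi p.2 = 0) ->
  phi (\prod_(p <- s) p.2) = 0.

Definition fps_in b (p : fps A) := forall n, B b (p n).

Let B0 b : B b 0.
Proof. by rewrite -[0](addNr 1) -scaleN1r; apply: Blin. Qed.
Let BD b x y : B b x -> B b y -> B b (x + y).
Proof. by rewrite -[x in B b (x + _)]scale1r; apply: Blin. Qed.
Let BZ b c x : B b x -> B b (c *: x).
Proof. by move=> Bx; rewrite -[_ *: x]addr0; apply: Blin => //; apply: B0. Qed.
Let Bsum b n (F : 'I_n -> A) : (forall i, B b (F i)) -> B b (\sum_i F i).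
Proof. by move=> BF; elim/big_ind: _ => //; exact: BD. Qed.
Let BX b x k : B b x -> B b (x ^+ k).
Proof. by move=> Bx; elim: k => [|k IH]; rewrite ?expr0 // exprS; apply: BM. Qed.

Lemma fps_in_resolv b g x : B b x -> fps_in b (resolv g x).
Proof. by move=> Bx n; apply: Bsum => k; apply: BZ; apply: BX. Qed.
Lemma fps_in_algM b f p : fps_in b p -> fps_in b (fps_alg A f * p).
Proof. by move=> Bp n; rewrite fcoef_algM; apply: Bsum => k; apply: BZ. Qed.
Lemma fps_in_Mconst b x p : B b x -> fps_in b p -> fps_in b (p * fps_const x).
Proof. by move=> Bx Bp n; rewrite fcoefMC; apply: BM. Qed.
Lemma fps_in_sub1 b p : fps_in b p -> fps_in b (p - 1).
Proof.
move=> Bp n; rewrite fcoefB fcoef1 -scaler_nat -scaleNr addrC.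
exact: Blin.
Qed.

Fixpoint alt_word (X : bool -> fps A) b m : fps A :=
  if m is m'.+1 then X b * alt_word X (~~ b) m' else 1.

(** Each coefficient of an alternating product of series is a sum of alternating products of their
    coefficients, all centered. *)
Lemma fps_free X b m : (forall b, fps_in b (X b)) ->
  (forall b, fps_state phi (X b) = 0) -> fps_state phi (alt_word X b m.+1) = 0.
Proof.
move=> inX X0.
(* The list [l] holds the coefficients already picked from the left; its last tag differs from the
   tag [b] of the next series. *)
have gen k n (l : seq (bool * A)) : forall b, 
    (k != 0)%N || (l != [::]) ->
    sorted (fun p q => p.1 != q.1) l ->
    (if l is p :: l' then (last p l').1 != b else true) ->
    (forall p, p \in l -> B p.1 p.2 /\ phi p.2 = 0) ->
    phi ((\prod_(p <- l) p.2) * alt_word X b k n) = 0.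
  elim: k n l => [|k IH] n l {}b kl sl lb Bl.
    rewrite [alt_word _ _ _]/= fcoef1; case: (n == 0)%N; last by rewrite mulr0 raddf0.
    by rewrite mulr1 free.
  rewrite [alt_word _ _ _]/= fcoefM mulr_sumr raddf_sum big1 //= => i _; rewrite mulrA.
  have -> : (\prod_(p <- l) p.2) * X b i = \prod_(p <- rcons l (b, X b i)) p.2.
    by rewrite -cats1 big_cat big_seq1.
  apply: IH.
  - by rewrite -size_eq0 size_rcons orbT.
  - by case: l sl lb {kl Bl} => //= p l sl lb; rewrite rcons_path sl.
  - by case: l {sl lb kl Bl} => [|p l] /=; rewrite ?last_rcons /=; case: b.
  - move=> p; rewrite mem_rcons inE => /predU1P[->|/Bl //].
    split; first exact: inX.
    exact: (congr1 (fun f : fps K => f i) (X0 b)).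
apply/fpsP => n; rewrite /fps_state.
by have := gen m.+1 n [::] b; rewrite big_nil mul1r; apply.
Qed.

(** [(u * v) ^+ k.+1] is itself an alternating word of centered letters; constant series reduce this
    to [fps_free]. *)
Lemma free_centered u v k : B true u -> B false v -> phi u = 0 -> phi v = 0 ->
  phi ((u * v) ^+ k.+1) = 0.
Proof.
move=> Bu Bv u0 v0; pose X (s : bool) := fps_const (if s then u else v).
have XE j : alt_word X true j.*2 = fps_const ((u * v) ^+ j).
  elim: j => [|j IH]; first by rewrite expr0 rmorph1.
  by rewrite doubleS /= IH exprS !rmorphM mulrA.
have Xin s : fps_in s (X s) by move=> [|i]; [case: s|exact: B0].
have X0 s : fps_state phi (X s) = 0.
  by apply/fpsP => -[|i]; rewrite /fps_state ?raddf0 //; case: s.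
have := congr1 (fun f : fps K => f 0%N) (@fps_free X true k.*2.+1 Xin X0).
by rewrite -doubleS XE.
Qed.

(** Each [v] in the word is split as [v' + phi v]. The centered part leaves the word alternating;
    the scalar part merges neighbouring powers of [u], which stay centered. *)
Lemma free_haar u v k : B true u -> B false v -> (forall j, phi (u ^+ j.+1) = 0) ->
  phi ((u * v) ^+ k.+1) = 0.
Proof.
move=> Bu Bv u0; pose c := phi v; pose v' := v - c%:A.
have Bv' : B false v'.
  by rewrite /v' -scaleNr addrC; apply: Blin.
have v'0 : phi v' = 0 by rewrite /v' raddfB /= scalarZ phi1 mulr1 subrr.
(* Prefixes that are empty or end in the algebra of [v], so that a power of [u] may follow. *)
pose good (l : seq (bool * A)) := [/\ sorted (fun p q => p.1 != q.1) l,
  forall p, p \in l -> B p.1 p.2 /\ phi p.2 = 0 &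
  if l is p :: l' then (last p l').1 = false else true].
have goodP l j : good l ->
    sorted (fun p q => p.1 != q.1) (rcons l (true, u ^+ j.+1)) /\
    forall p, p \in rcons l (true, u ^+ j.+1) -> B p.1 p.2 /\ phi p.2 = 0.
  case=> sl cl ll; split.
    by case: l sl ll {cl} => //= p l sl ll; rewrite rcons_path sl ll.
  by move=> p; rewrite mem_rcons inE => /predU1P[->|/cl //]; split => //=; apply: BX.
have goodS l j : good l -> good (rcons (rcons l (true, u ^+ j.+1)) (false, v')).
  move=> /(goodP _ j)[sl cl]; split.
  - by case: l sl {cl} => //= p l sl; rewrite rcons_path sl last_rcons.
  - by move=> p; rewrite mem_rcons inE => /predU1P[->|/cl].
  - by case: l {sl cl} => //= p l; rewrite last_rcons.
have prod_rcons (l : seq (bool * A)) p :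
    \prod_(q <- rcons l p) q.2 = (\prod_(q <- l) q.2) * p.2.
  by rewrite -cats1 big_cat big_seq1.
have vE : v = v' + c%:A by rewrite subrK.
have free0 l : l != [::] -> sorted (fun p q => p.1 != q.1) l ->
    (forall p, p \in l -> B p.1 p.2 /\ phi p.2 = 0) ->
    phi (\prod_(p <- l) p.2) = 0 by exact: free.
(* The word is read as a settled prefix, a pending power of [u], and a remainder starting with
   [v]. *)
suff gen l j : good l ->
    phi ((\prod_(p <- l) p.2) * u ^+ j.+1 * (v * (u * v) ^+ k)) = 0.
  have := gen [::] 0%N; rewrite big_nil mul1r expr1 mulrA -exprS; apply.
  by split.
elim: k l j => [|k IH] l j gl.
  have [s1 c1] := goodP l j gl; have [s2 c2 _] := goodS l j gl.
  rewrite expr0 mulr1 vE mulrDr raddfD /= mulr_algr scalarZ.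
  rewrite -(prod_rcons _ (true, _)) -(prod_rcons _ (false, v')).
  by rewrite !free0 ?mulr0 ?addr0 // -size_eq0 size_rcons.
rewrite [(u * v) ^+ k.+1]exprS {1}vE mulrDl mulrDr raddfD /=.
rewrite mulr_algl -scalerAr scalarZ.
(* The letter [v'] closes the pending power and a new one starts; the scalar [c] raises the pending
   power by one. *)
have := IH _ 0%N (goodS l j gl); rewrite !prod_rcons /= expr1.
have := IH l j.+1 gl; rewrite [u ^+ j.+2]exprSr -!mulrA => -> ->.
by rewrite mulr0 addr0.
Qed.

(** Final cancellation in [key], where [p] stands for the resolvent [U]; the factors do not
    commute. *)
Lemma free_identity (S : nzRingType) (p a b : S) :
  p + (p * b - (a + 1) * b) - (p - 1) * (b + 1) = 1 - a * b.
Proof.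
rewrite !mulrDl mulNr !mulrDr !mul1r !mulr1 !opprD !opprK !addrA.
rewrite (ACl (1*6*2*5*4*7*8*3)) /=.
by rewrite subrr add0r subrr add0r addNr add0r.
Qed.

Section Product.
Variables (u v : A) (n : nat) (e : fps K).
Hypotheses (Bu : B true u) (Bv : B false v) (n_gt0 : (0 < n)%N).
Hypothesis phi_u : (fun k => phi (u ^+ k)) = rootgeom K n.
Hypothesis phi_v :
  fps_comp (fun k => phi (v ^+ k)) (fpsX ^+ n * e) = rootgeom K n.

Let x : fps A := fps_alg A fpsX.
Let chi : fps K := fpsX ^+ n.
Let d : fps A := fps_alg A (1 - chi).
Let U := resolv fpsX u.
Let V := resolv (chi * e) v.
(** By the resolvent equation this is [(V - 1) / chi], so that [b] below equals
    [((1 - chi) V - 1) / chi] without any division. *)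
Let V' := fps_alg A e * (V * fps_const v).
Let a := d * U - 1.
Let b := d * V' - 1.

Let dC p : d * p = p * d. Proof. exact: fps_algC. Qed.

Let UE : U = 1 + x * (U * fps_const u).
Proof. exact: resolv_rec. Qed.

Let X0 : @fpsX K 0%N = 0. Proof. by []. Qed.

Let chie0 : (chi * e) 0%N = 0.
Proof. by rewrite fcoef0M /chi fcoef0X X0 expr0n gtn_eqF ?mul0r. Qed.

Let VE : V = 1 + fps_alg A chi * V'.
Proof. by rewrite /V' mulrA -rmorphM; exact: resolv_rec. Qed.

Let dVE : d * V = 1 + fps_alg A chi * b.
Proof.
rewrite VE /b mulrDr mulr1 mulrBr mulr1 mulrA -(fps_algC chi d) -mulrA {1}/d.
by rewrite rmorphB rmorph1 -addrA [- _ + _]addrC.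
Qed.

Let chiP : (1 - chi) * rootgeom K n = 1.
Proof. exact: rootgeomP. Qed.

Let a_centered : fps_state phi a = 0.
Proof.
rewrite raddfB /= fps_stateZ fps_state1 // fps_state_resolv phi_u.
suff -> : fps_comp (rootgeom K n) fpsX = rootgeom K n by rewrite chiP subrr.
apply/fpsP => k; rewrite -[X in fps_comp _ X]expr1 fcoef_comp_Xn //.
by rewrite dvd1n divn1.
Qed.

(** [chi * b = (1 - chi) V - 1] has state zero, and multiplication by [chi = X^n] is injective. *)
Let b_centered : fps_state phi b = 0.
Proof.
suff chib : chi * fps_state phi b = 0.
  apply/fpsP => k; have := congr1 (fun f : fps K => f (n + k)%N) chib.
  by rewrite fcoefXnM leq_addr addKn.
rewrite -fps_stateZ (_ : _ * b = d * V - 1); last by rewrite dVE addrC addKr.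
by rewrite raddfB /= fps_stateZ fps_state1 // fps_state_resolv phi_v chiP subrr.
Qed.

Let R : fps A := 1 - fps_alg A (fpsX * e) * fps_const (u * v).

(** Since [X U u = U - 1] and [V' = e v V], the product [U R V] equals [U V - (U - 1) V']; the
    central factor [d] then brings in [a] and [b]. *)
Let key : d * (U * R * V) = 1 - a * b.
Proof.
have -> : U * R * V = U * V - (U - 1) * V'.
  have -> : U - 1 = x * (U * fps_const u) by rewrite {1}UE addrC addKr.
  have zE : fps_alg A (fpsX * e) = x * fps_alg A e by exact: rmorphM.
  have uvE : fps_const (u * v) = fps_const u * fps_const v by exact: rmorphM.
  rewrite /R mulrBr mulr1 mulrBl /V' -(resolvCl _ v) zE uvE !mulrA.
  rewrite -(fps_algC _ U) -/x -(mulrA _ (fps_const u) (fps_alg A e)).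
  by rewrite -(fps_algC e (fps_const u)) !mulrA.
have dV' : d * V' = b + 1 by rewrite subrK.
have dU : d * U = a + 1 by rewrite subrK.
rewrite mulrBr [d * (U * V)]mulrA [d * U]dC -mulrA dVE [d * ((U - 1) * _)]mulrA.
rewrite [d * (U - 1)]dC -mulrA dV'.
have -> : fps_alg A chi * b = b - d * b.
  by rewrite /d rmorphB rmorph1 mulrBl mul1r subKr.
rewrite mulrDr mulr1 mulrBr mulrA -[U * d]dC dU.
exact: free_identity.
Qed.

Let X_ (s : bool) := if s then a else b.

Let X_centered s : fps_state phi (X_ s) = 0.
Proof. by case: s; [exact: a_centered | exact: b_centered]. Qed.

Let X_in s : fps_in s (X_ s).
Proof.
case: s; apply: fps_in_sub1; do ?apply: fps_in_algM; first exact: fps_in_resolv.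
by apply: fps_in_Mconst => //; exact: fps_in_resolv.
Qed.

Let word_even k : alt_word X_ true k.*2 = (a * b) ^+ k.
Proof. by elim: k => //= k ->; rewrite exprS mulrA. Qed.

Let word_odd k : alt_word X_ true k.*2.+1 = (a * b) ^+ k * a.
Proof.
elim: k => [|k IH]; first by rewrite expr0 mul1r [LHS]mulr1.
by rewrite doubleS -[LHS]/(a * (b * alt_word X_ true k.*2.+1)) IH exprS !mulrA.
Qed.

Let P := resolv (fpsX * e) (u * v).

Let z0 : (fpsX * e) 0%N = 0. Proof. by rewrite fcoefXM. Qed.

Let PR : P * R = 1.
Proof.
have PE : P = 1 + fps_alg A (fpsX * e) * (P * fps_const (u * v)).
  exact: resolv_rec.
by rewrite /R mulrBr mulr1 mulrA -fps_algC -mulrA {1}PE addrK.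
Qed.

(** Truncation of [d V (1 - a b)^-1 U], which by [key] is the inverse [P] of [R]. *)
Let W M := d * (V * (\sum_(k < M) (a * b) ^+ k) * U).

Let PW M : W M = P - P * ((1 - x * fps_const u) * (a * b) ^+ M * U).
Proof.
have UU : (1 - x * fps_const u) * U = 1.
  rewrite mulrBl mul1r -mulrA {2}/U resolvCl -/U {1}UE addrK //.
have UdRV : d * (R * V) = (1 - x * fps_const u) * (1 - a * b).
  by rewrite -key !dC !mulrA UU mul1r.
have geo : (1 - a * b) * (\sum_(k < M) (a * b) ^+ k) = 1 - (a * b) ^+ M.
  by rewrite -opprB mulNr -subrX1 opprB.
transitivity (P * (R * W M)); first by rewrite mulrA PR mul1r.
rewrite -[X in X - _]mulr1 -mulrBr; congr (_ * _).
have -> : R * W M = d * (R * V) * (\sum_(k < M) (a * b) ^+ k) * U.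
  by rewrite /W mulrA -dC !mulrA.
by rewrite UdRV -(mulrA _ (1 - a * b)) geo mulrBr mulr1 mulrBl UU.
Qed.

Let state_word s m : fps_state phi (alt_word X_ s m) = (m == 0%N)%:R.
Proof.
case: m => [|m]; first exact: fps_state1.
by rewrite fps_free.
Qed.

(** One more factor [d] turns the outer factors into [1 + chi b] and [1 + a], so [d W] is a
    combination of alternating words in [a] and [b]; among them only the empty word has nonzero
    state. *)
Let state_W M : fps_state phi (W M.+1) = rootgeom K n.
Proof.
have dW : d * W M.+1 = \sum_(k < M.+1) (alt_word X_ true k.*2
    + alt_word X_ true k.*2.+1 + fps_alg A chi *
      (alt_word X_ false k.*2.+1 + alt_word X_ false k.*2.+2)).
  have -> : d * W M.+1 =
      (1 + fps_alg A chi * b) * (\sum_(k < M.+1) (a * b) ^+ k) * (1 + a).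
    by rewrite /W -dVE [1 + _]addrC subrK [RHS]mulrA -(dC (_ * _)) !mulrA.
  rewrite mulr_sumr mulr_suml; apply: eq_bigr => k _.
  rewrite -[alt_word X_ false _.+1]/(b * alt_word X_ true k.*2).
  rewrite -[alt_word X_ false _.+2]/(b * alt_word X_ true k.*2.+1).
  rewrite word_odd word_even -mulrDr -mulrA.
  have -> : (a * b) ^+ k * (1 + a) = (a * b) ^+ k + (a * b) ^+ k * a.
    by rewrite mulrDr mulr1.
  by rewrite [LHS]mulrDl mul1r -[_ * b * _]mulrA.
have : fps_state phi (d * W M.+1) = 1.
  have stD p q : fps_state phi (p + q) = fps_state phi p + fps_state phi q.
    exact: raddfD.
  have term k : fps_state phi (alt_word X_ true k.*2 + alt_word X_ true k.*2.+1
      + fps_alg A chi * (alt_word X_ false k.*2.+1 + alt_word X_ false k.*2.+2))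
      = (k == 0%N)%:R.
    by rewrite !stD fps_stateZ stD !state_word !addr0 mulr0 addr0 double_eq0.
  rewrite dW raddf_sum big_ord_recl big1 => [|k _]; last exact: term.
  by rewrite addr0; exact: term 0%N.
rewrite fps_stateZ => e1.
by rewrite -[LHS]mul1r -chiP -mulrA mulrCA mulrC e1 mul1r.
Qed.

Theorem free_product_series :
  fps_comp (fun k => phi ((u * v) ^+ k)) (fpsX * e) = rootgeom K n.
Proof.
rewrite -fps_state_resolv -/P; apply/fpsP => m.
(* At [X = 0] both [U] and [d] are 1, so [a] has no constant term. Hence the error term in [PW] does
   not reach coefficient [m] when [M = m.+1]. *)
have ab0 : (a * b) 0%N = 0.
  have a0 : a 0%N = 0.
    rewrite /a fcoefB fcoef_algM big_ord1 subn0.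
    rewrite /U /resolv big_ord1 !expr0 fcoefB !fcoef1 /chi fcoef0X X0 expr0n.
    by rewrite (gtn_eqF n_gt0) subr0 !scale1r subrr.
  by rewrite fcoef0M a0 mul0r.
have v1 : vanish m.+1 ((a * b) ^+ m.+1) by exact: vanishX.
have v2 : vanish m.+1 (P * ((1 - x * fps_const u) * (a * b) ^+ m.+1 * U)).
  rewrite mulrA; apply: vanishMr; rewrite mulrA.
  by rewrite -[m.+1]add0n; apply: vanishM.
rewrite -(state_W m) PW; set Q := P * _ in v2 *.
have -> : fps_state phi (P - Q) = fps_state phi P - fps_state phi Q.
  exact: raddfB.
have Qm : fps_state phi Q m = 0 by rewrite /fps_state v2 // raddf0.
by rewrite fcoefB Qm subr0.
Qed.

End Product.
End FreeProduct.

(** * Moments determine a law on the circle *)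

Section StepPolynomials.
Variable R : realType.
Implicit Types (r s u : R) (n m : nat).

(* These polynomials in [s] decrease from 1 to 0 on [0, 1] and converge there to
   the indicator function of [s < 1/2]. *)
Definition step_poly n s : R := (1 - s ^+ (2 * n)) ^+ (n * 4 ^ n).

(** Each of the [n] terms of [1 + ... + r^(n-1)] is at least [r^n]. *)
Lemma geom_decay r n : 0 <= r <= 1 -> n%:R * r ^+ n * (1 - r) <= 1 - r ^+ n.
Proof.
move=> /andP[r0 r1]; elim: n => [|n IH]; first by rewrite !mul0r expr0 subrr.
have rn0 : 0 <= r ^+ n by exact: exprn_ge0.
have rn1 : r ^+ n <= 1 by exact: exprn_ile1.
rewrite -natr1 exprS.
have h1 : r * (n%:R * r ^+ n * (1 - r)) <= r * (1 - r ^+ n) by exact: ler_wpM2l.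
have h2 : 0 <= (1 - r) * (1 - r * r ^+ n).
  by rewrite mulr_ge0 // subr_ge0 // mulr_ile1.
nra.
Qed.

Lemma bernoulli_ge u m : 0 <= u <= 1 -> 1 - m%:R * u <= (1 - u) ^+ m.
Proof.
move=> /andP[u0 u1]; elim: m => [|m IH]; first by rewrite mul0r subr0.
rewrite exprS -natr1; have h0 : 0 <= 1 - u by lra.
have := ler_wpM2l h0 IH; have m0 : 0 <= m%:R :> R by [].
by nra.
Qed.

(** The induction rests on [(1 - u) (1 + (m+1) u) <= 1 + m u]. *)
Lemma bernoulli_le u m : 0 <= u <= 1 -> (1 - u) ^+ m * (1 + m%:R * u) <= 1.
Proof.
move=> /andP[u0 u1]; elim: m => [|m IH]; first by rewrite mul0r addr0 mulr1.
apply: le_trans IH; rewrite exprSr -mulrA; apply: ler_wpM2l.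
  by apply: exprn_ge0; lra.
have m0 : 0 <= m%:R :> R by [].
by rewrite -natr1; nra.
Qed.

Lemma step_poly_itv n s : 0 <= s <= 1 -> 0 <= step_poly n s <= 1.
Proof.
move=> /andP[s0 s1]; have u0 := exprn_ge0 (2 * n) s0.
have u1 := exprn_ile1 (2 * n) s0 s1.
by apply/andP; split; [apply: exprn_ge0; lra | apply: exprn_ile1; lra].
Qed.

Lemma cvg_step_poly s : 0 <= s <= 1 ->
  step_poly n s @[n --> \oo] --> (if s < 2^-1 then 1 else 0 : R).
Proof.
move=> s01; have /andP[s0 s1] := s01.
have u01 n : 0 <= s ^+ (2 * n) <= 1.
  by rewrite exprn_ge0 ?exprn_ile1.
(* The exponent times [s^(2n)] is [n (2s)^(2n)]: it tends to 0 if [s < 1/2] and is at least [n]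
   otherwise. The factor [n] is what settles [s = 1/2]. *)
have mu n : (n * 4 ^ n)%:R * s ^+ (2 * n) = n%:R * ((2 * s) ^+ n) ^+ 2.
  rewrite natrM natrX -mulrA; congr (_ * _).
  rewrite exprM -exprMn -[RHS]exprM mulnC [RHS]exprM.
  by congr (_ ^+ n); ring.
case: ltP => s2.
- pose r := 2 * s; have r0 : 0 <= r by rewrite /r; lra.
  have r1 : r < 1 by rewrite /r; lra.
  apply: (@squeeze_cvgr _ _ _ _ (fun n => 1 - (1 - r)^-1 * r ^+ n) (cst 1)).
  + near=> n; have /andP[_ ->] := step_poly_itv n s01; rewrite andbT.
    apply: le_trans (bernoulli_ge _ (u01 n)); rewrite mu -/r lerD2l lerN2.
    (* One factor [r^n] absorbs [n] by [geom_decay]; the other tends to 0. *)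
    rewrite expr2 mulrA; apply: ler_wpM2r; first exact: exprn_ge0.
    rewrite -[leRHS]mul1r ler_pdivlMr ?subr_gt0 //.
    apply: le_trans (geom_decay n _) _; first by rewrite r0 ltW.
    by rewrite gerBl exprn_ge0.
  + rewrite -[X in _ --> X]subr0; apply: cvgB; first exact: cvg_cst.
    rewrite -(mulr0 (1 - r)^-1); apply: cvgMr; apply: cvg_expr.
    by rewrite ger0_norm.
  + exact: cvg_cst.
- apply: (@squeeze_cvgr _ _ _ _ (cst 0) (@harmonic R)).
  + near=> n; have /andP[-> _] /= := step_poly_itv n s01.
    (* The value is at most [1 / (1 + n (2s)^(2n))], hence at most [1 / (n + 1)]. *)
    have := bernoulli_le (n * 4 ^ n) (u01 n); rewrite mu => h.
    rewrite /harmonic -[leRHS]mul1r ler_pdivlMr //; apply: le_trans h.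
    apply: ler_wpM2l; first by have /andP[] := step_poly_itv n s01.
    rewrite -natr1 addrC lerD2l ler_peMr //.
    by rewrite exprn_ege1 // exprn_ege1 //; lra.
  + exact: cvg_cst.
  + exact: cvg_harmonic.
Unshelve. all: end_near. Qed.

End StepPolynomials.

Section ComplexParts.
Variable R : realType.
Implicit Types z w : R[i].

Lemma complexReM z w : complex.Re (z * w) =
  complex.Re z * complex.Re w - complex.Im z * complex.Im w.
Proof. by case: z => a b; case: w. Qed.

Lemma complexImM z w : complex.Im (z * w) =
  complex.Re z * complex.Im w + complex.Im z * complex.Re w.
Proof. by case: z => a b; case: w. Qed.

End ComplexParts.

(** * Measurability on the circle *)

Section CircleMeasurable.
Variable R : realType.
Implicit Types x : circle R.

Definition cre x : R := complex.Re (circle_val x).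
Definition cim x : R := complex.Im (circle_val x).

Lemma circle_sqr x : cre x ^+ 2 + cim x ^+ 2 = 1.
Proof.
apply: complexI; rewrite /cre /cim add_Re2_Im2 /circle_val (eqP (svalP x)).
by rewrite expr1n.
Qed.

Lemma circle_val_inj : injective (@circle_val R).
Proof. by move=> x y /val_inj. Qed.

Lemma measurable_circle_coord : measurable_fun setT (@circle_coord R : circle R -> _).
Proof. by move=> _ B mB; exists B. Qed.

Lemma measurable_cre : measurable_fun setT cre.
Proof. exact: (measurableT_comp measurable_fst measurable_circle_coord). Qed.

Lemma measurable_cim : measurable_fun setT cim.
Proof. exact: (measurableT_comp measurable_snd measurable_circle_coord). Qed.

Lemma measurable_to_circle d (T : measurableType d) (f : T -> circle R) :
  measurable_fun setT (cre \o f) -> measurable_fun setT (cim \o f) ->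
  measurable_fun setT f.
Proof.
move=> mre mim _ A [B mB <-]; rewrite setTI setTI -comp_preimage -[_ @^-1` _]setTI.
exact: (measurable_fun_pair mre mim).
Qed.

Lemma measurable_circle_ReX k : measurable_fun setT
  (fun x : circle R => complex.Re (circle_val x ^+ k)) /\
  measurable_fun setT (fun x : circle R => complex.Im (circle_val x ^+ k)).
Proof.
elim: k => [|k [IHre IHim]].
  by split; under eq_fun do rewrite expr0; exact: measurable_cst.
split.
  under eq_fun do rewrite exprS complexReM.
  by apply: measurable_funB; apply: measurable_funM => //;
    [exact: measurable_cre | exact: measurable_cim].
under eq_fun do rewrite exprS complexImM.
by apply: measurable_funD; apply: measurable_funM => //;
  [exact: measurable_cre | exact: measurable_cim].
Qed.

Lemma measurable_circle_pow n : measurable_fun setT (@circle_pow R n : circle R -> circle R).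
Proof.
by apply: measurable_to_circle; [exact: (measurable_circle_ReX n).1
  | exact: (measurable_circle_ReX n).2].
Qed.

(** A pi-system generating the Borel sets, on which laws are compared. *)
Definition quadrants : set (set (circle R)) :=
  [set A | exists a b, A = [set x | cre x < a /\ cim x < b]].

Lemma quadrants_setI : setI_closed quadrants.
Proof.
move=> _ _ [a [b ->]] [c [d ->]]; exists (Num.min a c), (Num.min b d).
apply/seteqP; split=> x /=; rewrite !lt_min.
  by move=> [[-> ->] [-> ->]].
by move=> [/andP[-> ->] /andP[-> ->]].
Qed.

Lemma cre_le1 x : `|cre x| <= 1.
Proof.
rewrite -(ler_pXn2r (n := 2)) ?nnegrE // expr1n real_normK ?num_real //.
by rewrite -(circle_sqr x) lerDl sqr_ge0.
Qed.

Lemma cim_le1 x : `|cim x| <= 1.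
Proof.
rewrite -(ler_pXn2r (n := 2)) ?nnegrE // expr1n real_normK ?num_real //.
by rewrite -(circle_sqr x) lerDr sqr_ge0.
Qed.

Lemma quadrant_setT : quadrants [set: circle R].
Proof.
(* The coordinates are at most 1, so a bound 2 imposes nothing; half-planes are obtained below in
   the same way. *)
exists 2, 2; apply/seteqP; split=> x // _; split.
  by have := cre_le1 x; have := ler_norm (cre x); lra.
by have := cim_le1 x; have := ler_norm (cim x); lra.
Qed.

Lemma measurable_quadrants : (measurable : set (set (circle R))) = <<s quadrants >>.
Proof.
apply/seteqP; split.
  move=> A [B mB <-].
  have mray (h : circle R -> R) : (forall a, quadrants [set x | h x < a]) ->
      measurable_fun setT (h : g_sigma_algebraType quadrants -> R).
    move=> hq; apply: (measurability (@RGenInftyO.G R)).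
      exact: RGenInftyO.measurableE.
    move=> _ [_ [a ->] <-]; apply: sub_sigma_algebra.
    rewrite setTI (_ : _ @^-1` _ = [set x | h x < a]); first exact: hq.
    by apply/seteqP; split=> x /=; rewrite in_itv.
  apply: (measurable_fun_pair (mray cre _) (mray cim _)) => //.
    move=> a; exists a, 2; apply/seteqP; split=> x /= => [xa|[]//]; split=> //.
    by have := cim_le1 x; have := ler_norm (cim x); lra.
  move=> a; exists 2, a; apply/seteqP; split=> x /= => [xa|[]//]; split=> //.
  by have := cre_le1 x; have := ler_norm (cre x); lra.
apply: smallest_sub; first exact: sigma_algebra_measurable.
move=> _ [a [b ->]].
rewrite (_ : mkset _ = (cre @^-1` `]-oo, a[%classic) `&` (cim @^-1` `]-oo, b[%classic)).
  apply: measurableI; rewrite -[X in measurable X]setTI.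
    exact: measurable_cre.
  exact: measurable_cim.
by apply/seteqP; split=> x /=; rewrite !in_itv.
Qed.

End CircleMeasurable.

(** * Trigonometric polynomials and the moment problem *)

Section MomentProblem.
Variable R : realType.
Implicit Types (m : probability (circle R) R) (x : circle R) (f g : circle R -> R).

(** Real trigonometric polynomials, as a linear span, so that moments determine their integrals by
    induction. *)
Inductive trig : (circle R -> R) -> Prop :=
| trig_re k : trig (fun x => complex.Re (circle_val x ^+ k))
| trig_im k : trig (fun x => complex.Im (circle_val x ^+ k))
| trig_lin c f g : trig f -> trig g -> trig (fun x => c * f x + g x).

Lemma trig_ext f g : f =1 g -> trig f -> trig g.
Proof. by move=> /funext ->. Qed.

Lemma trig_cst c : trig (fun=> c).
Proof.
apply: trig_ext (trig_lin c (trig_re 0) (trig_im 0)) => x.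
by rewrite expr0 /= mulr1 addr0.
Qed.

Lemma trigD f g : trig f -> trig g -> trig (fun x => f x + g x).
Proof. by move=> tf tg; apply: trig_ext (trig_lin 1 tf tg) => x; rewrite mul1r. Qed.

Lemma trigZ c f : trig f -> trig (fun x => c * f x).
Proof.
by move=> tf; apply: trig_ext (trig_lin c tf (trig_cst 0)) => x; rewrite addr0.
Qed.

(** Product-to-sum formula [2 Re z Re z^(k+1) = Re z^(k+2) + Re z^k] on the circle, and its analogue
    for [Im z^(k+1)]. *)
Lemma trig_cre f : trig f -> trig (fun x => cre x * f x).
Proof.
elim=> [[|k]|[|k]|c {}f g _ IHf _ IHg].
- by apply: trig_ext (trig_re 1) => x; rewrite expr0 expr1 mulr1.
- apply: trig_ext (trigZ 2^-1 (trigD (trig_re k.+2) (trig_re k))) => x.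
  rewrite 2!exprS !(complexReM, complexImM) -/(cre x) -/(cim x).
  have := circle_sqr x; set c := cre x; set s := cim x => cs.
  set p := complex.Re _; set q := complex.Im _.
  have : p * (c ^+ 2 + s ^+ 2) = p by rewrite cs mulr1.
  by clear cs; clearbody p q; lra.
- by apply: trig_ext (trig_cst 0) => x; rewrite expr0 mulr0.
- apply: trig_ext (trigZ 2^-1 (trigD (trig_im k.+2) (trig_im k))) => x.
  rewrite 2!exprS !(complexReM, complexImM) -/(cre x) -/(cim x).
  have := circle_sqr x; set c := cre x; set s := cim x => cs.
  set p := complex.Re _; set q := complex.Im _.
  have : q * (c ^+ 2 + s ^+ 2) = q by rewrite cs mulr1.
  by clear cs; clearbody p q; lra.
- apply: trig_ext (trig_lin c IHf IHg) => x; ring.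
Qed.

Lemma trig_cim f : trig f -> trig (fun x => cim x * f x).
Proof.
elim=> [[|k]|[|k]|c {}f g _ IHf _ IHg].
- by apply: trig_ext (trig_im 1) => x; rewrite expr0 expr1 mulr1.
- apply: trig_ext (trigZ 2^-1 (trig_lin (-1) (trig_im k) (trig_im k.+2))) => x.
  rewrite 2!exprS !(complexReM, complexImM) -/(cre x) -/(cim x).
  have := circle_sqr x; set c := cre x; set s := cim x => cs.
  set p := complex.Re _; set q := complex.Im _.
  have : q * (c ^+ 2 + s ^+ 2) = q by rewrite cs mulr1.
  by clear cs; clearbody p q; lra.
- by apply: trig_ext (trig_cst 0) => x; rewrite expr0 mulr0.
- apply: trig_ext (trigZ 2^-1 (trig_lin (-1) (trig_re k.+2) (trig_re k))) => x.
  rewrite 2!exprS !(complexReM, complexImM) -/(cre x) -/(cim x).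
  have := circle_sqr x; set c := cre x; set s := cim x => cs.
  set p := complex.Re _; set q := complex.Im _.
  have : p * (c ^+ 2 + s ^+ 2) = p by rewrite cs mulr1.
  by clear cs; clearbody p q; lra.
- apply: trig_ext (trig_lin c IHf IHg) => x; ring.
Qed.

(** Stated for any [h] whose multiplication preserves [trig], so that it applies to the two
    coordinates in turn. *)
Lemma trig_poly (h : circle R -> R) (p : {poly R}) :
  (forall f, trig f -> trig (fun x => h x * f x)) ->
  forall f, trig f -> trig (fun x => p.[h x] * f x).
Proof.
move=> th; elim/poly_ind: p => [|p c IH] f tf.
  by apply: trig_ext (trig_cst 0) => x; rewrite horner0 mul0r.
apply: trig_ext (trigD (IH _ (th _ tf)) (trigZ c tf)) => x.
by rewrite hornerMXaddC; ring.
Qed.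

Lemma trig_measurable f : trig f -> measurable_fun setT f.
Proof.
elim=> [k|k|c {}f g _ mf _ mg].
- exact: (measurable_circle_ReX R k).1.
- exact: (measurable_circle_ReX R k).2.
- by apply: measurable_funD => //; apply: measurable_funM.
Qed.

Lemma trig_bounded f : trig f -> exists M, forall x, `|f x| <= M.
Proof.
elim=> [k|k|c {}f g _ [M fM] _ [N gN]].
- exists 1 => x; exact: cre_le1 (circle_pow k x).
- exists 1 => x; exact: cim_le1 (circle_pow k x).
- exists (`|c| * M + N) => x; apply: le_trans (ler_normD _ _) _.
  by rewrite normrM lerD // ler_wpM2l.
Qed.

Lemma bounded_integrable m f M : measurable_fun setT f ->
  (forall x, `|f x| <= M) -> m.-integrable setT (EFin \o f).
Proof.
move=> mf fM; apply: measurable_bounded_integrable => //.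
  exact: fin_num_fun_lty.
by exists M; split; [exact: num_real | move=> N MN x _; apply: le_trans (ltW MN)].
Qed.

Lemma trig_integrable m f : trig f -> m.-integrable setT (EFin \o f).
Proof.
move=> tf; have [M fM] := trig_bounded tf.
exact: bounded_integrable (trig_measurable tf) fM.
Qed.

Lemma Rintegral_probability_cst m (c : R) : \int[m]_x c = c.
Proof.
rewrite Rintegral_cst // -[RHS]mulr1; congr (_ * _).
exact: (congr1 fine (probability_setT m)).
Qed.

Lemma trig_integral m1 m2 f : (forall k, (0 < k)%N -> moment m1 k = moment m2 k) ->
  trig f -> \int[m1]_x f x = \int[m2]_x f x.
Proof.
move=> mE; elim=> [[|k]|[|k]|c {}f g tf IHf tg IHg].
(* Order zero is not covered by [mE]: both integrals are the total mass 1. *)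
- transitivity (1 : R); first exact: Rintegral_probability_cst.
  by symmetry; exact: Rintegral_probability_cst.
- by case: (mE k.+1 isT).
- transitivity (0 : R); first exact: Rintegral_probability_cst.
  by symmetry; exact: Rintegral_probability_cst.
- by case: (mE k.+1 isT).
- have ti m h : trig h -> m.-integrable setT (EFin \o h) by exact: trig_integrable.
  rewrite !RintegralD ?RintegralZl ?IHf ?IHg //; do ?exact: ti.
  + exact: ti (trigZ c tf).
  + exact: ti (trigZ c tf).
Qed.

Lemma trig_integralE m1 m2 f :
  (forall k, (0 < k)%N -> moment m1 k = moment m2 k) -> trig f ->
  (\int[m1]_x (f x)%:E = \int[m2]_x (f x)%:E)%E.
Proof.
move=> mE tf; have fin m : (\int[m]_x (f x)%:E)%E \is a fin_num.
  by apply: integrable_fin_num => //; exact: trig_integrable.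
by rewrite -(fineK (fin m1)) -(fineK (fin m2)); congr EFin; exact: trig_integral.
Qed.

(** [step_poly] after the affine map that sends [a] to [1/2] and [[-1, 1]] into [[0, 1]]. *)
Definition ray_poly (a : R) n : {poly R} :=
  (1 - (2^-1%:P + (2 * (1 + `|a|))^-1 *: ('X - a%:P)) ^+ (2 * n)) ^+ (n * 4 ^ n).

Lemma ray_polyE a n (c : R) :
  (ray_poly a n).[c] = step_poly n (2^-1 + (c - a) / (2 * (1 + `|a|))).
Proof. by rewrite /ray_poly /step_poly !hornerE mulrC. Qed.

Lemma ray_itv a (c : R) : `|c| <= 1 -> 0 <= 2^-1 + (c - a) / (2 * (1 + `|a|)) <= 1.
Proof.
move=> c1; have d0 : 0 < 2 * (1 + `|a|) by have := normr_ge0 a; lra.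
have : `|(c - a) / (2 * (1 + `|a|))| <= 2^-1.
  rewrite normrM normfV (gtr0_norm d0) ler_pdivrMr //.
  apply: le_trans (ler_normB _ _) _; have -> : 2^-1 * (2 * (1 + `|a|)) = 1 + `|a|.
    by field.
  by rewrite lerD2r.
by rewrite ler_norml; lra.
Qed.

Lemma ray_poly_itv a n (c : R) : `|c| <= 1 -> 0 <= (ray_poly a n).[c] <= 1.
Proof. by move=> c1; rewrite ray_polyE step_poly_itv ?ray_itv. Qed.

Lemma cvg_ray_poly a (c : R) : `|c| <= 1 ->
  (ray_poly a n).[c] @[n --> \oo] --> (if c < a then 1 else 0 : R).
Proof.
move=> c1; under eq_fun do rewrite ray_polyE.
have d0 : 0 < (2 * (1 + `|a|))^-1 by rewrite invr_gt0; have := normr_ge0 a; lra.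
have -> : (c < a) = (2^-1 + (c - a) / (2 * (1 + `|a|)) < 2^-1).
  by rewrite -[RHS](ltrD2l (- 2^-1)) addKr addNr pmulr_llt0 // subr_lt0.
exact: cvg_step_poly (ray_itv _ _).
Qed.

Lemma measurable_quadrant (a b : R) :
  measurable [set x : circle R | cre x < a /\ cim x < b].
Proof.
by rewrite measurable_quadrants; apply: sub_sigma_algebra; exists a, b.
Qed.

(** Dominated convergence with the constant bound 1. The factor [1] in the integrand is the seed to
    which [trig_poly] is applied twice. *)
Lemma cvg_quadrant m (a b : R) :
  (\int[m]_x ((ray_poly a n).[cre x] * ((ray_poly b n).[cim x] * 1))%:E)%E
    @[n --> \oo] --> m [set x | cre x < a /\ cim x < b].
Proof.
set A := mkset _; have mA : measurable A by exact: measurable_quadrant.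
pose f n x := ((ray_poly a n).[cre x] * ((ray_poly b n).[cim x] * 1))%:E.
have tf n : trig (fun x => (ray_poly a n).[cre x] * ((ray_poly b n).[cim x] * 1)).
  apply: trig_poly; first exact: trig_cre.
  by apply: trig_poly (trig_cst 1); exact: trig_cim.
have mf n : measurable_fun setT (f n).
  by apply/measurable_EFinP; exact: trig_measurable.
have fA x : f n x @[n --> \oo] --> (\1_A x)%:E.
  apply: cvg_EFin; first exact: nearW.
  have -> : \1_A x =
      (if cre x < a then 1 else 0) * ((if cim x < b then 1 else 0) * 1) :> R.
    rewrite indicE; case: ifPn => ha; case: ifPn => hb;
      rewrite ?mulr1 ?mul1r ?mul0r ?mulr0.
    - by rewrite mem_set.
    - by rewrite memNset // => -[_]; exact/negP.
    - by rewrite memNset // => -[+ _]; exact/negP.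
    - by rewrite memNset // => -[+ _]; exact/negP.
  apply: cvgM; first exact: cvg_ray_poly (cre_le1 x).
  apply: cvgM; last exact: cvg_cst.
  exact: cvg_ray_poly (cim_le1 x).
have f1 n x : (`|f n x| <= 1)%E.
  rewrite lee_fin mulr1; have /andP[a0 a1] := ray_poly_itv a n (cre_le1 x).
  have /andP[b0 b1] := ray_poly_itv b n (cim_le1 x).
  by rewrite ger0_norm ?mulr_ge0 // mulr_ile1.
have mA1 : measurable_fun setT (fun x => (\1_A x)%:E : \bar R).
  by apply/measurable_EFinP; exact: measurable_indic.
have fA' : \forall x \ae m, setT x -> f n x @[n --> \oo] --> (\1_A x)%:E.
  by apply: aeW => x _; exact: fA.
have f1' : \forall x \ae m, forall n, setT x ->
    (`|f n x| <= (EFin \o cst (1%R : R)) x)%E.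
  by apply: aeW => x n _; exact: f1.
have := dominated_convergence measurableT mf mA1 fA'
  (finite_measure_integrable_cst m 1 measurableT) f1'.
by case=> _ _; rewrite integral_indic // setIT.
Qed.

Theorem moment_inj m1 m2 : (forall k, (0 < k)%N -> moment m1 k = moment m2 k) ->
  same_law m1 m2.
Proof.
move=> mE A mA.
apply: (measure_unique (@quadrants R) (fun=> [set: circle R])) => //.
- exact: measurable_quadrants.
- exact: quadrants_setI.
- by move=> _; exact: quadrant_setT.
- by rewrite bigcup_const.
- move=> _ [a [b ->]].
  (* The mass of a quadrant is a limit of integrals of trigonometric polynomials, on which both laws
     agree. *)
  have lE m := cvg_lim (@ereal_hausdorff R) (@cvg_quadrant m a b).
  apply: etrans (esym (lE _ m1)) _; apply: etrans _ (lE _ m2).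
  congr (lim (_ @ \oo)).
  apply/funext => n; apply: trig_integralE => //.
  apply: trig_poly; first exact: trig_cre.
  by apply: trig_poly (trig_cst 1); exact: trig_cim.
- move=> _; exact: le_lt_trans (probability_le1 m1 measurableT) (ltry 1).
Qed.

End MomentProblem.

(** * Moments from the transform chi *)

Section RealPowerSeries.
Variable R : realType.
Implicit Types (r M : R) (a e : nat -> R).

Definition psum r a (N : nat) : R := \sum_(1 <= n < N) r ^+ n * a n.

Lemma psumS r a N : psum r a N.+2 = psum r a N.+1 + r ^+ N.+1 * a N.+1.
Proof. by rewrite /psum big_nat_recr. Qed.

Lemma psum1 r a : psum r a 1 = 0.
Proof. by rewrite /psum big_nil. Qed.

Lemma cvg_psum r a M : 0 <= r < 1 -> (forall n, `|a n| <= M) -> cvgn (psum r a).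
Proof.
move=> /andP[r0 r1] aM.
pose u n := if n == 0%N then 0 else r ^+ n * a n.
have -> : psum r a = series u.
  apply/funext => -[|N]; first by rewrite /psum /series /= !big_geq.
  rewrite /psum /series /= [RHS]big_ltn // /u eqxx add0r.
  by apply: eq_big_nat => -[].
apply: normed_cvg.
apply: (@series_le_cvg _ _ (fun n => M * r ^+ n)) => [n|n|n|] /=.
- exact: normr_ge0.
- by rewrite mulr_ge0 ?exprn_ge0 // (le_trans (normr_ge0 (a 0%N))).
- rewrite /u; case: (n == 0%N).
    by rewrite normr0 mulr_ge0 ?exprn_ge0 // (le_trans (normr_ge0 (a 0%N))).
  by rewrite normrM mulrC (ger0_norm (exprn_ge0 n r0)) ler_wpM2r ?exprn_ge0.
- have -> : (fun n => M * r ^+ n) = geometric M r by [].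
  by apply: is_cvg_geometric_series; rewrite ger0_norm.
Qed.

(** Beyond the lowest term the sum is dominated by a geometric one; the factor [1 - r] keeps the
    bound free of quotients. *)
Lemma psum_tail r a M n N : 0 <= r < 1 -> (forall n, `|a n| <= M) ->
  (forall k, (0 < k < n)%N -> a k = 0) -> (0 < n)%N ->
  `|psum r a (n + N).+1 - r ^+ n * a n| * (1 - r) <= M * r ^+ n.+1 * (1 - r ^+ N).
Proof.
move=> /andP[r0 r1] aM a0 n0; elim: N => [|N IH].
  rewrite addn0 expr0 subrr mulr0 /psum big_nat_recr //= big1_seq.
    by rewrite add0r subrr normr0 mul0r.
  by move=> k /andP[_]; rewrite mem_index_iota => /a0 ->; rewrite mulr0.
rewrite addnS psumS addrAC.
apply: le_trans (ler_wpM2r _ (ler_normD _ _)) _; first by rewrite subr_ge0 ltW.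
rewrite mulrDl; apply: le_trans (lerD IH (_ : _ <= M * r ^+ (n + N).+1 * (1 - r))) _.
  rewrite normrM (ger0_norm (exprn_ge0 _ r0)) ler_wpM2r ?subr_ge0 ?(ltW r1) //.
  by rewrite mulrC ler_wpM2r ?exprn_ge0.
by rewrite -addSn exprD [r ^+ N.+1]exprS le_eqVlt; apply/orP; left; apply/eqP; ring.
Qed.

(** Comparing the vanishing sum with its lowest term gives [|e n| (1 - r) <= M r] for all [r], which
    fails for small [r] unless [e n = 0]. *)
Lemma power_series_inj e M : (forall n, `|e n| <= M) ->
  (forall r, 0 < r < 1 -> psum r e N @[N --> \oo] --> 0) ->
  forall n, (0 < n)%N -> e n = 0.
Proof.
move=> eM e0 n; elim/ltn_ind: n => n IH n0.
have {}IH k : (0 < k < n)%N -> e k = 0 by move=> /andP[k0 kn]; exact: IH.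
have M0 : 0 <= M by exact: le_trans (normr_ge0 (e 0%N)) (eM 0%N).
have bnd r : 0 < r < 1 -> `|e n| * (1 - r) <= M * r.
  move=> r01; have /andP[r0 r1] := r01.
  have rn : 0 < r ^+ n by exact: exprn_gt0.
  rewrite -(ler_pM2l rn) [leRHS]mulrCA -exprSr mulrA.
  rewrite -(gtr0_norm rn) -normrM.
  have cv : `|psum r e N - r ^+ n * e n| * (1 - r) @[N --> \oo] -->
      `|0 - r ^+ n * e n| * (1 - r).
    apply: cvgMl; apply: cvg_norm; apply: cvgB; [exact: e0 | exact: cvg_cst].
  rewrite -normrN -sub0r -(cvg_lim _ cv) //.
  apply: limr_le; first by apply/cvg_ex; eexists; exact: cv.
  near=> N; have nN : (n < N)%N by near: N; exact: nbhs_infty_gt.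
  have -> : N = (n + (N - n.+1)).+1 by rewrite -addSn subnKC.
  apply: le_trans (psum_tail _ _ eM IH n0) _; first by rewrite ltW.
  by rewrite ler_piMr ?mulr_ge0 ?exprn_ge0 ?gerBl ?exprn_ge0 // ltW.
apply/eqP; case: eqP => // /eqP en0.
have ep : 0 < `|e n| by rewrite normr_gt0.
have Mp : 0 < M by exact: lt_le_trans ep (eM n).
have d0 : 0 < `|e n| + 2 * M by lra.
(* For this [r] one has [1 - r = 2 M / (|e n| + 2 M)], so the bound would read
   [2 M |e n| <= M |e n|]. *)
have := bnd (`|e n| / (`|e n| + 2 * M)); rewrite divr_gt0 //= ltr_pdivrMr // mul1r.
rewrite ltrDl mulr_gt0 // => /(_ isT).
have -> : 1 - `|e n| / (`|e n| + 2 * M) = 2 * M / (`|e n| + 2 * M).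
  by field; rewrite lt0r_neq0.
rewrite !mulrA ler_pM2r ?invr_gt0 // leNgt => /negP; case.
by nra.
Unshelve. all: end_near. Qed.

Lemma cvg_psum_dvd r j : (0 < j)%N -> 0 < r < 1 ->
  psum r (fun n => (j %| n)%N%:R) N @[N --> \oo] --> r ^+ j / (1 - r ^+ j).
Proof.
move=> j0 /andP[r0 r1].
have rj : 1 - r ^+ j != 0 by rewrite subr_eq0 eq_sym lt_eqF // exprn_ilt1 ?ltW // -lt0n.
(* There are [N %/ j] positive multiples of [j] up to [N], so this is a finite geometric sum of
   ratio [r^j]. *)
have psE N : psum r (fun n => (j %| n)%N%:R) N.+1 =
    (r ^+ j - r ^+ (j * (N %/ j).+1)) / (1 - r ^+ j).
  elim: N => [|N IH]; first by rewrite psum1 div0n muln1 subrr mul0r.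
  rewrite psumS IH divnS //; case: (boolP (j %| N.+1)%N) => [jN|jN]; last first.
    by rewrite mulr0 addr0 add0n.
  have -> : N.+1 = (j * (N %/ j).+1)%N.
    by rewrite -{1}(divnK jN) divnS // jN mulnC.
  rewrite mulr1 add1n [(j * _.+2)%N]mulnS exprD; set q := r ^+ (j * _).
  by field.
rewrite -cvg_shiftS /=; under eq_fun do rewrite psE.
apply: cvgMl; rewrite -[X in _ --> X]subr0; apply: cvgB; first exact: cvg_cst.
apply: (@squeeze_cvgr _ _ _ _ (cst 0) (fun n => r ^+ n)).
- near=> N; apply/andP; split; first by apply: exprn_ge0; exact: ltW.
  apply: ler_wiXn2l; [exact: ltW | exact: ltW |].
  by rewrite mulnC; apply: ltnW; exact: ltn_ceil.
- exact: cvg_cst.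
- by apply: cvg_expr; rewrite ger0_norm // ltW.
Unshelve. all: end_near. Qed.

End RealPowerSeries.

Local Open Scope complex_scope.

(** * Moments and transforms of laws on the circle *)

Section Moments.
Variable R : realType.
Implicit Types (m : probability (circle R) R).

Lemma Rintegral_le1 m (f : circle R -> R) : measurable_fun setT f ->
  (forall x, `|f x| <= 1) -> `|\int[m]_x f x| <= 1.
Proof.
move=> mf f1; have fi := bounded_integrable m mf f1.
apply: le_trans (le_normr_Rintegral measurableT fi) _.
have absi : m.-integrable setT (EFin \o (fun x => `|f x|)).
  apply: (@bounded_integrable R m _ 1) => [|x]; last by rewrite normr_id.
  exact: measurableT_comp.
have onei : m.-integrable setT (EFin \o cst (1 : R)).
  exact: finite_measure_integrable_cst.
rewrite -[leRHS](Rintegral_probability_cst m (1 : R)).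
by apply: le_Rintegral => //.
Qed.

Lemma Re_moment_le1 m k : `|complex.Re (moment m k)| <= 1.
Proof.
apply: Rintegral_le1 => [|x]; first exact: (measurable_circle_ReX R k).1.
exact: cre_le1 (circle_pow k x).
Qed.

Lemma Im_moment_le1 m k : `|complex.Im (moment m k)| <= 1.
Proof.
apply: Rintegral_le1 => [|x]; first exact: (measurable_circle_ReX R k).2.
exact: cim_le1 (circle_pow k x).
Qed.

Lemma moment0 m : moment m 0 = 1.
Proof.
apply/eqP; rewrite eq_complex /moment /=; apply/andP; split; apply/eqP.
  exact: Rintegral_probability_cst.
exact: Rintegral_probability_cst.
Qed.

Lemma same_law_moment m1 m2 k : same_law m1 m2 -> moment m1 k = moment m2 k.
Proof.
by move=> m12; congr (_ +i* _); congr fine; apply: eq_measure_integral => A mA _;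
  exact: m12.
Qed.

HB.instance Definition _ n := isMeasurableFun.Build _ _ _ _
  (@circle_pow R n : circle R -> circle R) (@measurable_circle_pow R n).

Lemma moment_pow m n k :
  moment (distribution m (@circle_pow R n : circle R -> circle R)) k = moment m (n * k).
Proof.
congr (_ +i* _); rewrite /Rintegral integral_pushforward //=.
- by congr fine; apply: eq_integral => x _ /=; rewrite exprM.
- by apply/measurable_EFinP; exact: (measurable_circle_ReX R k).1.
- rewrite preimage_setT; apply: (@bounded_integrable R m _ 1) => [|x] /=.
    exact: (measurableT_comp (measurable_circle_ReX R k).1 (@measurable_circle_pow R n)).
  exact: cre_le1 (circle_pow k (circle_pow n x)).
- by congr fine; apply: eq_integral => x _ /=; rewrite exprM.
- by apply/measurable_EFinP; exact: (measurable_circle_ReX R k).2.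
- rewrite preimage_setT; apply: (@bounded_integrable R m _ 1) => [|x] /=.
    exact: (measurableT_comp (measurable_circle_ReX R k).2 (@measurable_circle_pow R n)).
  exact: cim_le1 (circle_pow k (circle_pow n x)).
Qed.

Let neg1 : circle R := circle_opp (circle_one R).

Lemma Rintegral_two_point (f : circle R -> R) : measurable_fun setT f ->
  (forall x, `|f x| <= 1) ->
  \int[two_point_law R]_x f x = (f (circle_one R) + f neg1) / 2.
Proof.
(* Shifting by 1 makes the integrand nonnegative, as required for additivity in the measure. *)
move=> mf f1; pose g x := f x + 1.
have g0 x : 0 <= g x by have := f1 x; rewrite ler_norml /g; lra.
have mg : measurable_fun setT g by apply: measurable_funD.
have fi := bounded_integrable (two_point_law R) mf f1.
have : \int[two_point_law R]_x g x = (g (circle_one R) + g neg1) / 2.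
  rewrite /Rintegral /two_point_law.
  rewrite (_ : integral _ _ _ = ((2^-1 * g (circle_one R) + 2^-1 * g neg1)%:E)%E) /=.
    by field.
  have mg' : measurable_fun setT (fun x => (g x)%:E) by apply/measurable_EFinP.
  have g0' x : [set: circle R] x -> (0 <= (g x)%:E)%E by rewrite lee_fin.
  rewrite ge0_integral_measure_add // !ge0_integral_mscale // !integral_dirac //.
  by rewrite !diracT !mul1e.
rewrite /g RintegralD // ?Rintegral_probability_cst; last first.
  exact: finite_measure_integrable_cst.
by lra.
Qed.

Lemma moment_two_point k : moment (two_point_law R) k = (2 %| k)%N%:R.
Proof.
have [mre mim] := measurable_circle_ReX R k.
rewrite /moment !Rintegral_two_point //; last 2 first.
- by move=> x; exact: cim_le1 (circle_pow k x).
- by move=> x; exact: cre_le1 (circle_pow k x).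
rewrite /= !expr1n -[(- 1)%R]/(-1) dvdn2.
apply/eqP; rewrite eq_complex /= -signr_odd; case: (odd k); rewrite ?expr0 ?expr1 /=.
  by rewrite subrr oppr0 addr0 mul0r !eqxx.
have -> : (1 + 1) / 2 = 1 :> R by field.
by rewrite addr0 mul0r !eqxx.
Qed.

Lemma cvg_complex (u v : R^nat) (a b : R) :
  u n @[n --> \oo] --> a -> v n @[n --> \oo] --> b ->
  (fun n => u n +i* v n : R[i]^o) @ \oo --> (a +i* b : R[i]^o).
Proof.
(* A positive element of [R[i]] is real, which eliminates [e2]. *)
move=> ua vb; apply/cvgrPdist_lt => -[e1 e2]; rewrite ltcE /= => /andP[/eqP -> e0].
near=> n.
have un : `|a - u n| < e1 / 2 by near: n; apply: cvgr_dist_lt ua _ _; lra.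
have vn : `|b - v n| < e1 / 2 by near: n; apply: cvgr_dist_lt vb _ _; lra.
have -> : (a +i* b - (u n +i* v n)) = (a - u n) +i* (b - v n) by [].
rewrite normc_def /= ltcR.
have -> : e1 = Num.sqrt (e1 ^+ 2) by rewrite sqrtr_sqr gtr0_norm.
rewrite ltr_sqrt ?exprn_gt0 //.
rewrite -(real_normK (num_real (a - u n))) -(real_normK (num_real (b - v n))).
have := normr_ge0 (a - u n); have := normr_ge0 (b - v n).
move: (`|a - u n|) (`|b - v n|) un vn => p q *; nra.
Unshelve. all: end_near. Qed.

(** Only points strictly between 0 and 1 are used: there [psi] splits into two real series, and
    these already determine the moments. *)
Lemma psi_real m r : 0 < r < 1 ->
  psi m r%:C = limn (psum r (fun k => complex.Re (moment m k)))
            +i* limn (psum r (fun k => complex.Im (moment m k))).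
Proof.
move=> /andP[r0 r1]; have r01 : 0 <= r < 1 by rewrite ltW.
have cre := cvg_psum r01 (Re_moment_le1 m).
have cim := cvg_psum r01 (Im_moment_le1 m).
have sE : (fun N => \sum_(1 <= n < N) r%:C ^+ n * moment m n : R[i]^o) =
    fun N => psum r (fun k => complex.Re (moment m k)) N
      +i* psum r (fun k => complex.Im (moment m k)) N.
  apply/funext => N.
  rewrite /psum; elim/big_ind3: _ => // [x c d y c' d' -> ->|k _] //.
  rewrite -rmorphXn; case: (moment m k) => a b.
  by apply/eqP; rewrite eq_complex /= !mul0r subr0 addr0 !eqxx.
rewrite /psi sE.
have h := cvg_complex cre cim.
exact: (cvg_lim (@norm_hausdorff _ (R[i]^o : normedModType R[i])) h).
Qed.

Lemma two_point_chi r : 0 < r < 1 -> chi (two_point_law R) r%:C = (r ^+ 2)%:C.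
Proof.
move=> r01; have /andP[r0 r1] := r01.
have r2 : 1 - r ^+ 2 != 0 by nra.
have -> : chi (two_point_law R) r%:C =
   let p := (r ^+ 2 / (1 - r ^+ 2))%:C in p / (1 + p).
  rewrite /chi psi_real //=.
  have -> : (fun k => complex.Re (moment (two_point_law R) k)) =
      fun k => (2 %| k)%N%:R.
    by apply/funext => k; rewrite moment_two_point; case: dvdn.
  have -> : (fun k => complex.Im (moment (two_point_law R) k)) = (fun k => 0).
    by apply/funext => k; rewrite moment_two_point; case: dvdn.
  rewrite (cvg_lim _ (cvg_psum_dvd (j := 2) isT r01)) //.
  have -> : psum r (fun=> 0) = cst 0.
    by apply/funext => N; rewrite /psum big1 // => k _; rewrite mulr0.
  by rewrite lim_cst.
have ->/= : (r ^+ 2)%:C = (r ^+ 2 / (1 - r ^+ 2) / (1 + r ^+ 2 / (1 - r ^+ 2)))%:C.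
  by congr (_ %:C); field; rewrite r2 subrK oner_eq0.
by rewrite [RHS]fmorph_div rmorphD rmorph1.
Qed.

(** Inverting [chi = psi / (1 + psi)] gives [psi = r^j / (1 - r^j)], the sum of [r^n] over the
    positive multiples of [j]; coefficients are then compared. *)
Lemma moment_chi_root m j : (0 < j)%N ->
  (forall r, 0 < r < 1 -> chi m r%:C = (r ^+ j)%:C) ->
  forall k, (0 < k)%N -> moment m k = (j %| k)%N%:R.
Proof.
move=> j0 chiE.
have psiE r : 0 < r < 1 -> psi m r%:C = (r ^+ j / (1 - r ^+ j))%:C.
  move=> r01; have /andP[r0 r1] := r01; have := chiE r r01; rewrite /chi.
  set p := psi _ _ => pE.
  have rj : r ^+ j != 0 by rewrite expf_neq0 // gt_eqF.
  have rj1 : 1 - r ^+ j != 0.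
    by rewrite subr_eq0 eq_sym lt_eqF // exprn_ilt1 ?ltW // -lt0n.
  (* If [1 + p = 0], the quotient would be 0 by the convention for inverses, against [r^j != 0]. *)
  have p1 : 1 + p != 0.
    apply/eqP => p0; move: pE; rewrite p0 invr0 mulr0 => /eqP.
    by rewrite eq_sym -(rmorph0 (real_complex R)) (inj_eq (@complexI _)) (negbTE rj).
  have pq : p = (r ^+ j)%:C * (1 + p) by rewrite -pE mulfVK.
  rewrite [RHS]fmorph_div rmorphB rmorph1 /=.
  have rc1 : 1 - (r ^+ j)%:C != 0 :> R[i].
    by rewrite -(rmorph1 (real_complex R)) -rmorphB fmorph_eq0.
  apply: (mulIf rc1); rewrite divfK // mulrBr mulr1 {1}pq.
  by ring.
have r01' (r : R) : 0 < r < 1 -> 0 <= r < 1 by move=> /andP[r0 ->]; rewrite ltW.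
have reE : forall k, (0 < k)%N -> complex.Re (moment m k) - (j %| k)%N%:R = 0.
  apply: (@power_series_inj _ _ 2) => [k|r r01].
    apply: le_trans (ler_normB _ _) _; have := Re_moment_le1 m k.
    by case: dvdn; rewrite ?normr1 ?normr0; lra.
  have -> : psum r (fun k => complex.Re (moment m k) - (j %| k)%N%:R) =
      fun N => psum r (fun k => complex.Re (moment m k)) N
        - psum r (fun k => (j %| k)%N%:R) N.
    apply/funext => N; rewrite /psum -sumrB; apply: eq_bigr => k _.
    by rewrite mulrBr.
  rewrite -(subrr (r ^+ j / (1 - r ^+ j))); apply: cvgB; last exact: cvg_psum_dvd.
  have <- : limn (psum r (fun k => complex.Re (moment m k))) = r ^+ j / (1 - r ^+ j).
    by have := psiE r r01; rewrite psi_real // => -[].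
  exact: cvg_psum (r01' _ r01) (Re_moment_le1 m).
have imE : forall k, (0 < k)%N -> complex.Im (moment m k) = 0.
  apply: (@power_series_inj _ _ 1) => [k|r r01]; first exact: Im_moment_le1.
  have <- : limn (psum r (fun k => complex.Im (moment m k))) = 0.
    by have := psiE r r01; rewrite psi_real // => -[].
  exact: cvg_psum (r01' _ r01) (Im_moment_le1 m).
move=> k k0; have /eqP := reE k k0; rewrite subr_eq0 => /eqP rek.
by apply/eqP; rewrite eq_complex imE // rek; case: dvdn; rewrite /= !eqxx.
Qed.

End Moments.

(** * Convolutions of the two-point law *)

Section TwoPoint.
Variable R : realType.
Implicit Types (m : probability (circle R) R) (p : circle R).

Let one : circle R := circle_one R.
Let neg1 : circle R := circle_opp (circle_one R).

Lemma measurable_circle1 p : measurable [set p].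
Proof.
rewrite (_ : [set p] = (@cre R @^-1` [set cre p]) `&` (@cim R @^-1` [set cim p])).
  apply: measurableI; rewrite -[X in measurable X]setTI.
    exact: measurable_cre.
  exact: measurable_cim.
apply/seteqP; split=> [x -> //|x [/= re im]].
by apply: circle_val_inj; apply/eqP; rewrite eq_complex; apply/andP; split; apply/eqP.
Qed.

Lemma one_neq_neg1 : one <> neg1.
Proof. by move=> /(congr1 (@cre R)); rewrite /cre /=; lra. Qed.

Lemma two_pointE A : two_point_law R A = (2^-1 * \1_A one + 2^-1 * \1_A neg1)%:E.
Proof. by rewrite /two_point_law measure_addE. Qed.

Lemma ge_two_point m A :
  (2^-1%:E <= m [set one])%E -> (2^-1%:E <= m [set neg1])%E ->
  measurable A -> (two_point_law R A <= m A)%E.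
Proof.
move=> m1 mN1 mA; rewrite two_pointE.
have mAp p : measurable (A `&` [set p]).
  by apply: measurableI => //; exact: measurable_circle1.
have half p : (2^-1%:E <= m [set p])%E -> ((2^-1 * \1_A p)%:E <= m (A `&` [set p]))%E.
  move=> mp; rewrite indicE; have [Ap|nAp] := boolP (p \in A); last by rewrite mulr0.
  by rewrite mulr1 setIidr // => _ ->; rewrite inE in Ap.
rewrite EFinD; apply: le_trans (leeD (half _ m1) (half _ mN1)) _.
rewrite -measureU //; last first.
  apply/seteqP; split=> // x [[_ /= xo] [_ /= xn]].
  by apply: one_neq_neg1; rewrite -xo.
apply: le_measure; rewrite ?inE //; first exact: measurableU.
by move=> x [[]|[]].
Qed.

(** The inequality applied to complements is the reverse one. *)
Lemma le_probability_same_law m1 m2 :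
  (forall A, measurable A -> (m1 A <= m2 A)%E) -> same_law m2 m1.
Proof.
move=> le12 A mA; apply/eqP; rewrite eq_le (le12 _ mA) andbT.
have := le12 _ (measurableC mA); rewrite !probability_setC //.
rewrite -(fineK (fin_num_measure m1 A mA)) -(fineK (fin_num_measure m2 A mA)).
by rewrite -!EFinB !lee_fin; lra.
Qed.

Lemma two_point_unique m :
  (2^-1%:E <= m [set one])%E -> (2^-1%:E <= m [set neg1])%E ->
  same_law m (two_point_law R).
Proof.
by move=> m1 mN1; apply: le_probability_same_law => A; exact: ge_two_point.
Qed.

(** A product of two independent fair signs is a fair sign; by [two_point_unique] it suffices that
    [1] and [-1] each have mass at least one half. *)
Lemma classical_two_point nu :
  is_classical_mconv (two_point_law R) (two_point_law R) nu ->
  same_law nu (two_point_law R).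
Proof.
move=> [d [T [P [X [Y [XY lX lY lXY]]]]]].
have muE p : p = one \/ p = neg1 -> two_point_law R [set p] = (2^-1)%:E.
  rewrite two_pointE !indicE; have nn := one_neq_neg1.
  case=> ->.
    by rewrite mem_set // memNset ?mulr0 ?addr0 ?mulr1 // => /esym.
  by rewrite memNset // mem_set // mulr0 add0r mulr1.
have mX p : measurable (X @^-1` [set p]).
  rewrite -[X in measurable X]setTI; apply: measurable_funP => //.
  exact: measurable_circle1.
have mY p : measurable (Y @^-1` [set p]).
  rewrite -[X in measurable X]setTI; apply: measurable_funP => //.
  exact: measurable_circle1.
pose E a b := X @^-1` [set a] `&` Y @^-1` [set b].
have mE a b : measurable (E a b) by exact: measurableI.
have PE a b : a = one \/ a = neg1 -> b = one \/ b = neg1 ->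
    P (E a b) = (2^-1 * 2^-1)%:E.
  move=> ha hb; rewrite XY; try exact: measurable_circle1.
  rewrite EFinM; congr (_ * _)%E.
    by rewrite -(muE a ha) -lX //; exact: measurable_circle1.
  by rewrite -(muE b hb) -lY //; exact: measurable_circle1.
have mXY : measurable_fun setT (fun w => circle_mul (X w) (Y w)).
  have mre f : measurable_fun setT (f : T -> circle R) ->
    measurable_fun setT (fun w => cre (f w)) by exact: measurableT_comp (@measurable_cre R).
  have mim f : measurable_fun setT (f : T -> circle R) ->
    measurable_fun setT (fun w => cim (f w)) by exact: measurableT_comp (@measurable_cim R).
  apply: measurable_to_circle.
    rewrite (_ : _ \o _ = fun w => cre (X w) * cre (Y w) - cim (X w) * cim (Y w)).
      by apply: measurable_funB; apply: measurable_funM; (apply: mre || apply: mim);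
        exact: measurable_funP.
    by apply/funext => w; rewrite /cre /cim -complexReM.
  rewrite (_ : _ \o _ = fun w => cre (X w) * cim (Y w) + cim (X w) * cre (Y w)).
    by apply: measurable_funD; apply: measurable_funM; (apply: mre || apply: mim);
      exact: measurable_funP.
  by apply/funext => w; rewrite /cre /cim -complexImM.
(* Two disjoint events of probability 1/4 each lead to the value [p]. *)
have half p a b a' b' : a = one \/ a = neg1 -> b = one \/ b = neg1 ->
    a' = one \/ a' = neg1 -> b' = one \/ b' = neg1 -> a <> a' ->
    circle_mul a b = p -> circle_mul a' b' = p -> (2^-1%:E <= nu [set p])%E.
  move=> ha hb ha' hb' aa' pE pE'.
  rewrite -lXY; last exact: measurable_circle1.
  have -> : (2^-1 : R)%:E = (P (E a b) + P (E a' b'))%E.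
    by rewrite !PE // -EFinD; congr EFin; field.
  rewrite -measureU //; last first.
    apply/seteqP; split=> // x [[/= xa _] [/= xa' _]].
    by apply: aa'; rewrite -xa -xa'.
  apply: le_measure; rewrite ?inE /=.
  - exact: measurableU.
  - by rewrite -[X in measurable X]setTI; apply: mXY => //; exact: measurable_circle1.
  - by move=> w [[/= -> ->]|[/= -> ->]].
have nn := one_neq_neg1.
apply: two_point_unique.
  apply: (@half one one one neg1 neg1) => //; try by [left | right].
  - by apply: circle_val_inj; rewrite /circle_val /= mulr1.
  - by apply: circle_val_inj; rewrite /circle_val /= mulrNN mulr1.
apply: (@half neg1 one neg1 neg1 one) => //; try by [left | right].
- by apply: circle_val_inj; rewrite /circle_val /= mul1r.
- by apply: circle_val_inj; rewrite /circle_val /= mulr1.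
Qed.

End TwoPoint.

(** * Free unitary Brownian motion *)

Section FreeUbm.
Variable R : realType.
Implicit Types (m nu rho : probability (circle R) R).

Lemma free_ubm_momentE (T : R) k : (0 < k)%N ->
  (free_ubm_moment T k)%:C = ubm_coef (expR (T / 2))%:C T%:C k.
Proof.
move=> k0; rewrite /ubm_coef gtn_eqF // /free_ubm_moment rmorphM rmorph_sum /=.
congr (_ * _).
  rewrite -rmorphXn -fmorphV -expRM_natl -expRN; congr (expR _)%:C.
  by rewrite mulrA mulNr.
apply: eq_bigr => j _; rewrite !rmorphM /= fmorphV !rmorph_nat rmorphXn rmorphN.
congr (_ * _).
have kz : k%:R != 0 :> R by rewrite pnatr_eq0 -lt0n.
by rewrite expfzDr // exprN1 rmorphM /= fmorphV rmorph_nat rmorphXn rmorph_nat.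
Qed.

Section FreeConvolution.
Variables (A : star_prob_space R) (u v : A).
Hypothesis uv : free_indep u v.

Let B (b : bool) : A -> Prop := if b then gen_star_subalg u else gen_star_subalg v.

Lemma gen_star_subalgP (w : A) : star_subalg (gen_star_subalg w).
Proof.
split.
- by move=> S [S1 _ _ _].
- move=> c a b aw bw S SS Sw; have [_ Sl _ _] := SS.
  by apply: Sl; [exact: aw | exact: bw].
- move=> a b aw bw S SS Sw; have [_ _ SM _] := SS.
  by apply: SM; [exact: aw | exact: bw].
- by move=> a aw S SS Sw; have [_ _ _ Sst] := SS; apply: Sst; exact: aw.
Qed.

Let BP b : star_subalg (B b).
Proof. by case: b; exact: gen_star_subalgP. Qed.

Let B1 b : B b 1.
Proof. by have [] := BP b. Qed.

Let Blin b (c : R[i]) x y : B b x -> B b y -> B b (c *: x + y).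
Proof. by have [_ h _ _] := BP b; exact: h. Qed.

Let BM b x y : B b x -> B b y -> B b (x * y).
Proof. by have [_ _ h _] := BP b; exact: h. Qed.

Let Bu : B true u. Proof. by move=> S. Qed.
Let Bv : B false v. Proof. by move=> S. Qed.

Let freeB s : s != [::] -> sorted (fun p q => p.1 != q.1) s ->
  (forall p, p \in s -> B p.1 p.2 /\ nc_state A p.2 = 0) ->
  nc_state A (\prod_(p <- s) p.2) = 0.
Proof.
move=> s0 ss sB; apply: uv => // p /sB[Bp p0]; split=> //.
Qed.

Lemma state_centered k : nc_state A u = 0 -> nc_state A v = 0 ->
  nc_state A ((u * v) ^+ k.+1) = 0.
Proof. exact: (free_centered B1 Blin freeB). Qed.

Lemma state_haar k : (forall j, nc_state A (u ^+ j.+1) = 0) ->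
  nc_state A ((u * v) ^+ k.+1) = 0.
Proof. exact: (free_haar (nc_state1 A) B1 Blin BM freeB). Qed.

(** [free_product_series] puts the moments of [u * v] in the form that [ubm_series_root] solves;
    coefficient [n * k] is then read off. *)
Lemma state_root n (s T : R[i]) k : (0 < n)%N -> s != 0 ->
  (forall k, nc_state A (u ^+ k) = (n %| k)%N%:R) ->
  (forall k, nc_state A (v ^+ k) = ubm_coef s T k) ->
  nc_state A ((u * v) ^+ (n * k)) = ubm_coef (s ^+ n) (n%:R * T) k.
Proof.
move=> n0 s0 uE vE.
have phi_u : (fun k => nc_state A (u ^+ k)) = rootgeom (R[i] : numFieldType) n.
  by apply/funext => j; rewrite uE /rootgeom fcoef_comp_Xn //; case: dvdn.
have phi_v : fps_comp (fun k => nc_state A (v ^+ k) : R[i])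
    (fpsX ^+ n * ubm_e n s T) = rootgeom (R[i] : numFieldType) n.
  have -> : (fun k => nc_state A (v ^+ k) : R[i]) = ubm_coef s T by apply/funext.
  exact: ubm_series_omega.
have := free_product_series (nc_state1 A) B1 Blin BM freeB Bu Bv n0 phi_u phi_v.
move=> /(ubm_series_root n0 s0) /(congr1 (fun f : fps _ => f (n * k)%N)) ->.
by rewrite (fcoef_comp_Xn n0) (dvdn_mulr _ (dvdnn n)) (mulKn _ n0).
Qed.

End FreeConvolution.

Variable lambda : R -> probability (circle R) R.
Hypothesis hlambda : forall t : R, 0 <= t -> free_ubm_law t (lambda t).

(** Common part of the cases [n = 2, 3, 4]: the convolutions enter only through the moments of
    [nu]. *)
Lemma pow_free_mconv n t nu rho : (0 < n)%N -> 0 <= t ->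
  (forall k, (0 < k)%N -> moment nu k = (n %| k)%N%:R) ->
  is_free_mconv nu (lambda t) rho ->
  same_law (pushforward rho (@circle_pow R n)) (lambda (n%:R * t)).
Proof.
move=> n0 t0 nuE [A [u [v [_ uv lu lv luv]]]].
apply: (@moment_inj R (distribution rho (@circle_pow R n : circle R -> circle R))).
move=> k k0; rewrite moment_pow -luv.
have nuE' j : nc_state A (u ^+ j) = (n %| j)%N%:R.
  by rewrite lu; case: j => [|j]; [rewrite moment0 dvdn0 | rewrite nuE].
have vE j : nc_state A (v ^+ j) = ubm_coef (expR (t / 2))%:C t%:C j.
  rewrite lv; case: j => [|j]; first by rewrite moment0.
  by rewrite -free_ubm_momentE // (hlambda t0).
have s0 : (expR (t / 2))%:C != 0 by rewrite fmorph_eq0 gt_eqF // expR_gt0.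
transitivity (free_ubm_moment (n%:R * t) k)%:C; last first.
  by symmetry; apply: hlambda => //; exact: mulr_ge0.
have sE : (expR (t / 2))%:C ^+ n = (expR (n%:R * t / 2))%:C.
  by rewrite -rmorphXn -expRM_natl mulrA.
have tE : n%:R * t%:C = (n%:R * t)%:C by rewrite rmorphM rmorph_nat.
by rewrite (free_ubm_momentE _ k0) -sE -tE; exact: state_root.
Qed.

(** The two-point law is centered, so all positive moments of [nu] vanish, and [state_haar] passes
    this on to [rho]. *)
Lemma free_mconv_haar t nu rho :
  is_free_mconv (two_point_law R) (two_point_law R) nu ->
  is_free_mconv nu (lambda t) rho -> same_law rho nu.
Proof.
move=> [A [u [v [_ uv lu lv luv]]]] [A' [u' [v' [_ uv' lu' _ luv']]]].
have nu0 k : moment nu k.+1 = 0.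
  rewrite -luv; apply: state_centered => //.
    by have := lu 1%N; rewrite expr1 moment_two_point.
  by have := lv 1%N; rewrite expr1 moment_two_point.
apply: moment_inj => -[//|k] _; rewrite nu0 -luv'; apply: state_haar => // j.
by rewrite lu'.
Qed.

End FreeUbm.

(** * Boolean and monotone convolution of the two-point law *)

Section BooleanMonotone.
Variable R : realType.
Implicit Types (nu : probability (circle R) R) (r : R).

Let norm_real_lt1 r : 0 < r < 1 -> `|r%:C| < 1 /\ r%:C != 0.
Proof.
move=> /andP[r0 r1]; rewrite fmorph_eq0 gt_eqF //.
by rewrite normc_def /= expr0n addr0 sqrtr_sqr gtr0_norm // ltcR.
Qed.

(** At real points [chi nu] is [r (r^2 / r)^2 = r^3]. *)
Lemma boolean_two_point_moment nu :
  is_boolean_mconv (two_point_law R) (two_point_law R) nu ->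
  forall k, (0 < k)%N -> moment nu k = (3 %| k)%N%:R.
Proof.
move=> nuE; apply: moment_chi_root => // r r01.
have [z1 z0] := norm_real_lt1 r01; have := nuE _ z1 z0.
rewrite /Ftrans two_point_chi // => /(canRL (mulVKf z0)) ->.
by rewrite !rmorphXn /=; field.
Qed.

(** At real points [chi nu] is [(r^2)^2 = r^4]. *)
Lemma monotone_two_point_moment nu :
  is_monotone_mconv (two_point_law R) (two_point_law R) nu ->
  forall k, (0 < k)%N -> moment nu k = (4 %| k)%N%:R.
Proof.
move=> nuE; apply: moment_chi_root => // r r01.
have [z1 _] := norm_real_lt1 r01; have /andP[r0 r1] := r01.
have r2 : 0 < r ^+ 2 < 1 by rewrite exprn_gt0 // exprn_ilt1 // ltW.
by rewrite nuE // two_point_chi // two_point_chi // -exprM.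
Qed.

End BooleanMonotone.

Theorem theorem1p2 (R : realType)
    (lambda : R -> probability (circle R) R)
    (hlambda : forall t : R, 0 <= t -> free_ubm_law t (lambda t))
    (t : R) (ht : 0 <= t) :
  let mu : probability (circle R) R := two_point_law R in
  [/\ forall nu rho : probability (circle R) R,
        is_free_mconv mu mu nu -> is_free_mconv nu (lambda t) rho ->
        same_law rho nu,
      forall nu rho : probability (circle R) R,
        is_classical_mconv mu mu nu -> is_free_mconv nu (lambda t) rho ->
        same_law (pushforward rho (@circle_pow R 2)) (lambda (2 * t)),
      forall nu rho : probability (circle R) R,
        is_boolean_mconv mu mu nu -> is_free_mconv nu (lambda t) rho ->
        same_law (pushforward rho (@circle_pow R 3)) (lambda (3 * t))
    & forall nu rho : probability (circle R) R,
        is_monotone_mconv mu mu nu -> is_free_mconv nu (lambda t) rho ->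
        same_law (pushforward rho (@circle_pow R 4)) (lambda (4 * t))].
Proof.
move=> mu; split=> nu rho.
- exact: free_mconv_haar.
- move=> nuE; apply: (@pow_free_mconv R lambda hlambda 2 t nu rho isT ht) => // k _.
  (* Classically [mu] is idempotent, and it is the uniform law on the square roots of unity. *)
  by rewrite (same_law_moment k (classical_two_point nuE)) moment_two_point.
- move=> nuE; apply: (@pow_free_mconv R lambda hlambda 3 t nu rho isT ht) => //.
  exact: boolean_two_point_moment.
- move=> nuE; apply: (@pow_free_mconv R lambda hlambda 4 t nu rho isT ht) => //.
  exact: monotone_two_point_moment.
Qed.
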